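(* Let $n \geq 1$, let $Z_1,\dots,Z_n$ be independent standard normal random variables, let $\lambda_1 \geq \dots \geq \lambda_n > 0$ be real numbers, let $a = (a_1,\dots,a_n) \in \mathbb{R}^n$, and put $W_a = \lambda_1 (Z_1 - a_1)^2 + \dots + \lambda_n (Z_n - a_n)^2$. Let $A_1 = \sum_{k=1}^n \lambda_k^2$ and $B_1 = \sum_{k=1}^n \lambda_k^2 a_k^2$. If $\lambda_1^2 \leq A_1/3$, then $$\frac{1}{4\sqrt{3}}\,\frac{1}{\sqrt{A_1 + B_1}} \leq M(W_a) \leq \frac{2}{\sqrt{A_1 + B_1}}.$$ Moreover, the left inequality holds without any assumption on $\lambda_1^2$.
   Context: The random variable $W_a$ has a probability density function $p(x,a)$ that is continuous on the positive half-axis $x>0$ (and $W_a>0$ almost surely). The functional $M(W_a) = \sup_{x} p(x,a)$ denotes the supremum of this density over the positive half-axis, a value in $(0,+\infty]$. *)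

(* Defs.v *)
From HB Require Import structures.
From mathcomp Require Import all_boot all_order all_algebra.
From mathcomp Require Import all_classical all_reals all_analysis.
Import Order.TTheory GRing.Theory Num.Theory.
Import numFieldNormedType.Exports.

Set Implicit Arguments.
Unset Strict Implicit.
Unset Printing Implicit Defensive.

Local Open Scope classical_set_scope.
Local Open Scope ring_scope.

Definition mutually_independent d (T : measurableType d) (R : realType)
    (P : probability T R) (n : nat) (Z : 'I_n -> {RV P >-> R}) : Prop :=
  forall (J : {set 'I_n}) (B : 'I_n -> set R),
    (forall i, measurable (B i)) ->
    P (\bigcap_(i in [set` J]) Z i @^-1` B i)
      = (\prod_(i in J) P (Z i @^-1` B i))%E.

Definition standard_normal d (T : measurableType d) (R : realType)
    (P : probability T R) (X : {RV P >-> R}) : Prop :=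
  forall B : set R, measurable B -> distribution P X B = normal_prob 0 1 B.

Definition quad_form_rv (T : Type) (R : realType) (n : nat)
    (lam a : 'I_n -> R) (Z : 'I_n -> T -> R) : T -> R :=
  fun w => \sum_(k < n) lam k * (Z k w - a k) ^+ 2.

Definition is_density d (T : measurableType d) (R : realType)
    (P : probability T R) (X : T -> R) (p : R -> R) : Prop :=
  [/\ measurable_fun [set: R] p,
      forall x, 0 <= p x &
      forall B : set R, measurable B ->
        P (X @^-1` B) = (\int[lebesgue_measure]_(x in B) (p x)%:E)%E].

(* The supremum is taken in the extended reals, so [+oo] is allowed; the values
   of the density off the positive half-axis are ignored. *)
Definition sup_density (R : realType) (p : R -> R) : \bar R :=
  ereal_sup [set (p x)%:E | x in `]0, +oo[].

(* Main.v *)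
Require Import Defs.
From HB Require Import structures.
From mathcomp Require Import all_boot all_order all_algebra.
From mathcomp Require Import all_classical all_reals all_analysis.
From mathcomp Require Import measurable_realfun ring lra.
Import Order.TTheory GRing.Theory Num.Theory.
Import numFieldNormedType.Exports.

(** Put [W = sum_k lam_k (Z_k - a_k)^2], [D = A1 + B1].

    Upper bound. The squared modulus of [E e^(i t W)] is, by independence, the
    product over [k] of [(1 + s_k)^(- 1 / 2) e^(- a_k^2 s_k / (1 + s_k))] with
    [s_k = 4 t^2 lam_k^2] ([normal_square_modulus],
    [charfun_modulus_sum_indep]). When [4 A1 t^2 / 3 <= 1] all the [s_k] are at
    most [1] and the modulus is at most [e^(- D t^2 / 2)]. For larger [t], the
    condition [lam_k^2 <= A1 / 3] and the concavity of [ln] give the modulus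
    the integrable decay [(1 + 4 A1 t^2 / 3)^(- 3 / 4) e^(- 3 B1 / (4 A1))]. So
    [|E e^(i t W)|] is dominated by an explicit function with integral at most
    [4 pi / sqrt D] ([integral_dominating_function]), and Fourier inversion
    bounds the density by [2 / sqrt D]. Inversion is carried out on Gaussian
    averages of the density around a point [x0] ([gaussian_smoothing_le]);
    these converge to the value at [x0] because the density is continuous
    there.

    Complex numbers do not appear: everything is expressed by [E cos (t W)]
    and [E sin (t W)]. The squared modulus for one term [Z_k] is
    computed by symmetrization, which reduces it to the real Fourier transform
    of a Gaussian ([gaussian_fourier]).

    Lower bound. A density bounded by [M] has second moment at least
    [1 / (12 M^2)] about any point, the extremal case being a uniform law
    ([density_second_moment_ge]). On the other hand the Laplace transform of
    [W - E W] is explicit and at most [e^(2 s^2 D / (1 - eta))] for small [s],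
    which gives [E (W - E W)^2 <= 4 D] in the limit
    ([quad_form_second_moment]). Comparing, [M^2 >= 1 / (48 D)]. *)

Set Implicit Arguments.
Unset Strict Implicit.
Unset Printing Implicit Defensive.

Local Open Scope classical_set_scope.
Local Open Scope ring_scope.

(** * Integrals against a density *)

Section integral_change_density.
Import HBNNSimple.
Local Open Scope ereal_scope.

(** Both sides are additive and continuous along increasing sequences in [f],
    so their equality on indicators extends to nonnegative functions. It is
    used twice: with [G] the density of a law, to compute expectations from
    that density, and with [G] a product of functions of the other variables
    of an independent family, to replace one factor of a product at a time. *)
Lemma ge0_integral_change_density d1 d2 (T1 : measurableType d1)
    (T2 : measurableType d2) (R : realType) (mu : {measure set T1 -> \bar R})
    (nu : {measure set T2 -> \bar R}) (G : T1 -> R) (X : T1 -> T2) (c : R) :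
  measurable_fun [set: T1] G -> (forall x, 0 <= G x)%R ->
  measurable_fun [set: T1] X -> (0 <= c)%R ->
  (forall B, measurable B ->
     \int[mu]_x (G x * \1_B (X x))%:E = c%:E * nu B) ->
  forall f : T2 -> R, measurable_fun [set: T2] f -> (forall y, 0 <= f y)%R ->
  \int[mu]_x (G x * f (X x))%:E = c%:E * \int[nu]_y (f y)%:E.
Proof.
move=> mG G0 mX c0 H f mf f0.
have meF : measurable_fun [set: T2] (fun y => (f y)%:E) by exact/measurable_EFinP.
pose f_ := nnsfun_approx measurableT meF.
have fcvg y : (fun n => (f_ n y : R)%:E) @ \oo --> (f y)%:E.
  by apply: cvg_nnsfun_approx => // z _; rewrite lee_fin.
have fnd y : {homo f_ ^~ y : m n / (m <= n)%N >-> (m <= n)%R}.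
  by move=> m n mn; exact/lefP/nd_nnsfun_approx.
have step (g : {nnsfun T2 >-> R}) :
    \int[mu]_x (G x * g (X x))%:E = c%:E * \int[nu]_y (g y)%:E.
  have m1 k : measurable_fun [set: T1]
      (fun x => (G x * \1_(g @^-1` [set k]) (X x))%R).
    by apply: measurable_funM => //; exact: measurableT_comp.
  transitivity (\sum_(k \in range g)
      \int[mu]_x (k%:E * (G x * \1_(g @^-1` [set k]) (X x))%:E)).
    rewrite -ge0_integral_fsum//; last 2 first.
    - by move=> k; apply/measurable_EFinP/measurable_funM.
    - move=> k x _; have [k0|k0] := leP 0%R k.
        by rewrite mule_ge0// lee_fin mulr_ge0.
      by rewrite preimage_nnfun0// indic0 mulr0 mule0.
    apply: eq_integral => x _.
    rewrite [in LHS]fimfunE EFinM -fsumEFin// ge0_mule_fsumr; last first.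
      by move=> k; rewrite nnfun_muleindic_ge0.
    apply: eq_fsbigr => k _.
    by rewrite !EFinM muleCA.
  transitivity (\sum_(k \in range g) (c%:E * (k%:E * nu (g @^-1` [set k])))).
    apply: eq_fsbigr => k _; have [k0|k0] := leP 0%R k.
      rewrite ge0_integralZl//.
      - by rewrite H// muleCA.
      - exact/measurable_EFinP.
      - by move=> x _; rewrite lee_fin mulr_ge0.
    rewrite preimage_nnfun0// measure0 !mule0.
    by under eq_integral do rewrite indic0 mulr0 mule0; rewrite integral0.
  rewrite -ge0_mule_fsumr; last first.
    move=> k; have [k0|k0] := leP 0%R k; first by rewrite mule_ge0.
    by rewrite preimage_nnfun0// measure0 mule0.
  by congr *%E; rewrite integralT_nnsfun// sintegralE.
transitivity (limn (fun n => \int[mu]_x (G x * f_ n (X x))%:E)).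
  rewrite -monotone_convergence//.
  - apply: eq_integral => x _; apply/esym/cvg_lim => //.
    under eq_fun do rewrite EFinM.
    by rewrite EFinM; apply: cvgeZl.
  - move=> n; apply/measurable_EFinP/measurable_funM => //.
    exact: measurableT_comp.
  - by move=> n x _; rewrite lee_fin mulr_ge0.
  - by move=> x _ m n mn; rewrite lee_fin ler_wpM2l// fnd.
under eq_fun do rewrite step.
have cvgf : (fun n => \int[nu]_y (f_ n y : R)%:E) @ \oo --> \int[nu]_y (f y)%:E.
  have -> : \int[nu]_y (f y)%:E = \int[nu]_y limn (fun n => (f_ n y)%:E).
    by apply: eq_integral => x _; apply/esym/cvg_lim.
  apply: cvg_monotone_convergence => //.
  - by move=> n; apply/measurable_EFinP.
  - by move=> n x _; rewrite lee_fin.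
  - by move=> x _ m n mn; rewrite lee_fin fnd.
by apply/cvg_lim => //; apply: cvgeZl.
Qed.

End integral_change_density.

(** * Products of functions of independent variables *)

Section independence.
Context d (T : measurableType d) (R : realType) (P : probability T R).

Lemma bounded_integrable (g : T -> R) (K : R) :
  measurable_fun [set: T] g -> (forall x, `|g x| <= K) ->
  P.-integrable [set: T] (EFin \o g).
Proof.
move=> mg gK; apply: measurable_bounded_integrable => //.
  by rewrite (le_lt_trans (probability_le1 P measurableT))// ltry.
by exists K; split; [exact: num_real|move=> M /ltW KM x _; exact: le_trans KM].
Qed.

(** Independence is the case of indicators. The general case follows by
    induction on the number [m] of factors that are not indicators: for the
    factor of index [m], the product of the other factors plays the part of
    a density. *)
Lemma ge0_integral_prod_indep (n : nat) (Z : 'I_n -> {RV P >-> R})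
    (f : 'I_n -> R -> R) (e : 'I_n -> R) :
  mutually_independent Z ->
  (forall k, measurable_fun [set: R] (f k)) -> (forall k x, 0 <= f k x) ->
  (forall k, (\int[P]_w (f k (Z k w))%:E = (e k)%:E)%E) ->
  (\int[P]_w (\prod_(k < n) f k (Z k w))%:E = (\prod_(k < n) e k)%:E)%E.
Proof.
move=> Zind mf0 f00 fe0.
suff main m : forall (f : 'I_n -> R -> R) (e : 'I_n -> R),
    (forall k, measurable_fun [set: R] (f k)) -> (forall k x, 0 <= f k x) ->
    (forall k, (\int[P]_w (f k (Z k w))%:E = (e k)%:E)%E) ->
    (forall k : 'I_n, (k < m)%N \/ exists2 B : set R, measurable B & f k = \1_B) ->
    (\int[P]_w (\prod_(k < n) f k (Z k w))%:E = (\prod_(k < n) e k)%:E)%E.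
  by apply: (main n) => // k; left.
clear mf0 f00 fe0 f e; elim: m => [|m IH] f e mf f0 fe Hf.
  have /choice[B HB] k : exists B : set R, measurable B /\ f k = \1_B.
    by case: (Hf k) => [|[B mB fB]]; [rewrite ltn0|exists B].
  have -> : (fun w => (\prod_(k < n) f k (Z k w))%:E) =
      (fun w => (\1_(\bigcap_(i in [set` [set: 'I_n]%SET]) Z i @^-1` B i) w)%:E).
    apply/funext => w; congr EFin; rewrite indicE.
    have [wB|] := boolP (w \in _).
      rewrite big1// => k _; rewrite (HB k).2 indicE.
      by move: wB; rewrite inE => /(_ k); rewrite /= inE => /(_ isT) ?; rewrite mem_set.
    rewrite notin_setE => /existsNP[k /not_implyP[_ wk]].
    by rewrite (bigD1 k)//= (HB k).2 indicE memNset// mul0r.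
  have mZ k : measurable (Z k @^-1` B k).
    by rewrite -[X in measurable X]setTI; apply: measurable_funP => //; exact: (HB k).1.
  rewrite integral_indic//; last first.
    by apply: fin_bigcap_measurable => //; exact: finite_finset.
  rewrite setIT; apply: eq_trans; first by apply: Zind => k; exact: (HB k).1.
  rewrite -prodEFin; apply: eq_big => [k|k _]; first by rewrite inE.
  by rewrite -fe (HB k).2 -[RHS]/(\int[P]_w (\1_(Z k @^-1` B k) w)%:E)%E
     integral_indic// setIT.
have [nm|mn] := leqP n m.
  by apply: IH => // k; left; rewrite (leq_trans (ltn_ord k)).
pose j := Ordinal mn.
have mfZ k : measurable_fun [set: T] (fun w => f k (Z k w)).
  by apply: measurableT_comp.
rewrite (bigD1 j)//= EFinM.
have -> : (fun w => (\prod_(k < n) f k (Z k w))%:E) =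
    (fun w => ((\prod_(k < n | k != j) f k (Z k w)) * f j (Z j w))%:E).
  by apply/funext => w; rewrite (bigD1 j)//= mulrC.
have e0 k : 0 <= e k.
  by rewrite -lee_fin -fe integral_ge0// => w _; rewrite lee_fin.
rewrite (@ge0_integral_change_density _ _ _ _ _ P (distribution P (Z j))
   (fun w => \prod_(k < n | k != j) f k (Z k w)) (Z j) (\prod_(k < n | k != j) e k))//.
- rewrite ge0_integral_distribution//.
  + by rewrite -[X in (_ * X)%E]/(\int[P]_w (f j (Z j w))%:E)%E fe muleC.
  + exact/measurable_EFinP.
  + by move=> y; rewrite lee_fin.
- by under eq_fun do rewrite -big_filter; exact: measurable_prod.
- by move=> w; apply: prodr_ge0.
- by apply: prodr_ge0.
move=> B mB.
have mZB : measurable (Z j @^-1` B).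
  by rewrite -[X in measurable X]setTI; apply: measurable_funP.
have PB : P (Z j @^-1` B) = (fine (P (Z j @^-1` B)))%:E.
  by rewrite fineK// fin_num_measure.
have -> : ((\prod_(k < n | k != j) e k)%:E * distribution P (Z j) B)%E =
    (\prod_(k < n) if k == j then fine (P (Z j @^-1` B)) else e k)%:E.
  rewrite [in RHS](bigD1 j)//= eqxx EFinM -PB muleC; congr (_ * _%:E)%E.
  by apply: eq_bigr => k /negbTE ->.
rewrite -(IH (fun k => if k == j then \1_B else f k)); first last.
- move=> k; have [->|kj] := eqVneq k j; first by right; exists B.
  case: (Hf k); last by right.
  rewrite ltnS leq_eqVlt => /predU1P[km|]; last by left.
  by move/eqP: kj; case; apply/val_inj.
- move=> k; case: eqP => [->|_]; last exact: fe.
  by rewrite -[LHS]/(\int[P]_w (\1_(Z j @^-1` B) w)%:E)%E integral_indic// setIT.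
- by move=> k x; case: eqP.
- by move=> k; case: eqP.
apply: eq_integral => w _; congr EFin.
rewrite [RHS](bigD1 j)//= eqxx mulrC; congr *%R.
by apply: eq_bigr => k kj; rewrite (negbTE kj).
Qed.

(** A bounded factor is the difference of a nonnegative one and a constant, and
    both sides are multilinear; signs are removed one factor at a time. *)
Lemma bounded_integral_prod_indep (n : nat) (Z : 'I_n -> {RV P >-> R})
    (f : 'I_n -> R -> R) (K : R) :
  mutually_independent Z ->
  (forall k, measurable_fun [set: R] (f k)) ->
  (forall k x, `|f k x| <= K) ->
  \int[P]_w (\prod_(k < n) f k (Z k w)) = \prod_(k < n) \int[P]_w f k (Z k w).
Proof.
move=> Zind mf0 fK0.
have mZ (h : 'I_n -> R -> R) :
    (forall k, measurable_fun [set: R] (h k)) -> forall k : 'I_n,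
    measurable_fun [set: T] (fun w => h k (Z k w)).
  by move=> mh k; apply: measurableT_comp.
have intf (h : 'I_n -> R -> R) (L : R) : (forall k, measurable_fun [set: R] (h k)) ->
    (forall k x, `|h k x| <= L) -> forall k : 'I_n,
    P.-integrable [set: T] (EFin \o (fun w => h k (Z k w))).
  by move=> mf fL k; apply: (bounded_integrable (mZ _ mf k) (fun w => fL k _)).
have intp (h : 'I_n -> R -> R) (L : R) : (forall k, measurable_fun [set: R] (h k)) ->
    (forall k x, `|h k x| <= L) ->
    P.-integrable [set: T] (EFin \o (fun w => \prod_(k < n) h k (Z k w))).
  move=> mf fL; apply: (@bounded_integrable _ (\prod_(k < n) L)).
    by apply: measurable_prod => k _; exact: mZ.
  by move=> w; rewrite normr_prod; apply: ler_prod => k _; rewrite normr_ge0 fL.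
suff main m : forall (f : 'I_n -> R -> R) (L : R),
    (forall k, measurable_fun [set: R] (f k)) -> (forall k x, `|f k x| <= L) ->
    (forall k : 'I_n, (k < m)%N \/ forall x, 0 <= f k x) ->
    \int[P]_w (\prod_(k < n) f k (Z k w)) = \prod_(k < n) \int[P]_w f k (Z k w).
  by apply: (main n _ _ mf0 fK0) => k; left.
clear mf0 fK0 f; elim: m => [|m IH] f L mf fL Hf.
  rewrite /Rintegral (@ge0_integral_prod_indep _ _ f (fun k => \int[P]_w f k (Z k w)))//.
    by move=> k x; case: (Hf k).
  move=> k; rewrite fineK//.
  by apply: integrable_fin_num => //; exact: (intf _ _ mf fL k).
have [nm|mn] := leqP n m.
  by apply: (IH _ L) => // k; left; rewrite (leq_trans (ltn_ord k)).
pose j := Ordinal mn.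
have L0 : 0 <= L by rewrite (le_trans _ (fL j 0)).
pose f1 (k : 'I_n) (x : R) := if k == j then f j x + L else f k x.
pose f2 (k : 'I_n) (x : R) := if k == j then L else f k x.
have mf1 (k : 'I_n) : measurable_fun [set: R] (f1 k).
  by rewrite /f1; case: eqP => // _; exact: measurable_funD.
have mf2 (k : 'I_n) : measurable_fun [set: R] (f2 k).
  by rewrite /f2; case: eqP => // _; exact: measurable_cst.
have f1L (k : 'I_n) x : `|f1 k x| <= L + L.
  rewrite /f1; case: eqP => [_|_]; last by rewrite (le_trans (fL k x))// lerDl.
  by rewrite (le_trans (ler_normD _ _))// lerD// ger0_norm.
have f2L (k : 'I_n) x : `|f2 k x| <= L + L.
  rewrite /f2; case: eqP => [_|_]; last by rewrite (le_trans (fL k x))// lerDl.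
  by rewrite ger0_norm// lerDl.
have H1 (k : 'I_n) : (k < m)%N \/ forall x, 0 <= f1 k x.
  rewrite /f1; case: eqP => [_|/eqP kj].
    by right=> x; have := fL j x; rewrite ler_norml -lerBlDr sub0r => /andP[].
  case: (Hf k) => [|?]; last by right.
  by rewrite ltnS leq_eqVlt => /predU1P[km|]; [move/eqP: kj; case; apply/val_inj|left].
have H2 (k : 'I_n) : (k < m)%N \/ forall x, 0 <= f2 k x.
  by rewrite /f2; case: eqP (H1 k) => [_ _|/eqP/negbTE kj]; [right|rewrite /f1 kj].
have -> : \int[P]_w (\prod_(k < n) f k (Z k w)) =
    \int[P]_w (\prod_(k < n) f1 k (Z k w)) - \int[P]_w (\prod_(k < n) f2 k (Z k w)).
  rewrite -RintegralB//; [|exact: intp f1L|exact: intp f2L].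
  apply: eq_Rintegral => w _; rewrite (bigD1 j)//= [X in X - _](bigD1 j)//=.
  rewrite [X in _ - X](bigD1 j)//= /f1 /f2 eqxx.
  have E u : \prod_(k < n | k != j) (if k == j then u k else f k (Z k w)) =
      \prod_(k < n | k != j) f k (Z k w).
    by apply: eq_bigr => k /negbTE ->.
  by rewrite !E -mulrBl addrK.
rewrite (IH _ _ mf1 f1L H1) (IH _ _ mf2 f2L H2)
  [X in X - _](bigD1 j)//= [X in _ - X](bigD1 j)//= [in RHS](bigD1 j)//= /f1 /f2 eqxx.
have E (u : R -> R) : \prod_(k < n | k != j)
      \int[P]_w (if k == j then u (Z k w) else f k (Z k w)) =
    \prod_(k < n | k != j) \int[P]_w f k (Z k w).
  by apply: eq_bigr => k /negbTE ->.
rewrite (E (fun x => f j x + L)) (E (fun=> L)).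
rewrite -mulrBl; congr *%R; rewrite RintegralD//; first by rewrite addrK.
- exact: (intf _ _ mf fL j).
- exact: finite_measure_integrable_cst.
Qed.

End independence.

(** * Derivatives and translations of integrals over the real line *)

Lemma integrable_scale d (T : measurableType d) (R : realType)
    (nu : {measure set T -> \bar R}) (f : T -> R) (c : R) :
  nu.-integrable [set: T] (EFin \o f) ->
  nu.-integrable [set: T] (EFin \o (fun w => c * f w)).
Proof. by move=> intf; exact: (integrableZl measurableT c intf). Qed.

Section real_calculus.
Context {R : realType}.
Notation mu := (@lebesgue_measure R).

Lemma cos_max (x : R) : `|cos x| <= 1.
Proof. by rewrite ler_norml cos_geN1 cos_le1. Qed.

Lemma measurable_cos : measurable_fun [set: R] (@cos R).
Proof. by apply: continuous_measurable_fun; exact: continuous_cos. Qed.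

Lemma measurable_sin : measurable_fun [set: R] (@sin R).
Proof. by apply: continuous_measurable_fun; exact: continuous_sin. Qed.

Lemma is_derive1_continuous (f f' : R -> R) :
  (forall x : R, is_derive x 1 f (f' x)) -> continuous f.
Proof.
move=> df x; apply: differentiable_continuous.
by apply/derivable1_diffP; have [] := df x.
Qed.

(** The next two lemmas restate the product and chain rules for functions
    written pointwise, the form in which integrands occur below. *)
Lemma is_derive1M (f g : R -> R) (x a b : R) :
  is_derive x 1 f a -> is_derive x 1 g b ->
  is_derive x 1 (fun y => f y * g y) (a * g x + f x * b).
Proof.
move=> df dg; have := is_deriveM df dg; rewrite (_ : f * g = fun y => f y * g y)//.
by move=> h; apply: is_derive_eq h _; rewrite /GRing.scale/= addrC mulrC.
Qed.

Lemma is_derive1_comp_fun (f g : R -> R) (x a b : R) :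
  is_derive (g x) 1 f a -> is_derive x 1 g b ->
  is_derive x 1 (fun y => f (g y)) (a * b).
Proof. exact: is_derive1_comp. Qed.

Lemma is_derive1_affine (a b x : R) : is_derive x 1 (fun y => a * y + b) a.
Proof.
have h := is_deriveD (is_deriveM (is_derive_cst a x 1) (is_derive_id x 1))
  (is_derive_cst b x 1).
rewrite (_ : (fun y => a * y + b) = cst a * id + cst b)//.
by apply: is_derive_eq h _; rewrite /GRing.scale/= mulr1 mulr0 !addr0.
Qed.

Lemma is_derive1_sqr (x : R) : is_derive x 1 (fun y => y ^+ 2) (2 * x).
Proof.
have h := is_derive1M (is_derive_id x 1) (is_derive_id x 1).
by apply: is_derive_eq h _; rewrite mul1r mulr1 -mulr2n mulr_natl.
Qed.

Lemma is_derive_integral (f f' : R -> R -> R) (G : R -> R) (a : R) :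
  (forall x, mu.-integrable [set: R] (EFin \o f x)) ->
  (forall x y : R, is_derive x 1 (f ^~ y) (f' x y)) ->
  (forall y, 0 <= G y) -> mu.-integrable [set: R] (EFin \o G) ->
  (forall x y, `|x - a| < 1 -> `|f' x y| <= G y) ->
  is_derive a 1 (fun x => \int[mu]_y f x y) (\int[mu]_y f' a y).
Proof.
move=> intf df G0 intG fG.
have Ia : `]a - 1, a + 1[%classic a by rewrite /= in_itv/= ltrBlDr ltrDl ltr01.
have d1 (x y : R) : partial1of2 f x y = f' x y.
  by rewrite partial1of2E; apply: derive_val.
have d2 (x y : R) : `]a - 1, a + 1[%classic x -> [set: R] y -> derivable (f ^~ y) x 1.
  by move=> _ _; have [] := df x y.
have d3 (x y : R) : `]a - 1, a + 1[%classic x -> [set: R] y ->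
    `|partial1of2 f x y| <= G y.
  rewrite /= in_itv/= => /andP[xa ax] _; rewrite d1; apply: fG.
  by rewrite ltr_norml; lra.
have e := differentiation_under_integral measurableT Ia (fun x _ => intf x) d2
  G0 intG d3.
apply: DeriveDef.
  exact: (derivable_under_integral measurableT Ia (fun x _ => intf x) d2
    G0 intG d3).
by rewrite -derive1E e; apply: eq_Rintegral => y _; exact: d1.
Qed.

Lemma continuous_integrable_le (f g : R -> R) :
  continuous f -> (forall x, `|f x| <= g x) ->
  mu.-integrable [set: R] (EFin \o g) -> mu.-integrable [set: R] (EFin \o f).
Proof.
move=> cf fg; apply: le_integrable => //.
  by apply/measurable_EFinP; exact: continuous_measurable_fun.
by move=> x _ /=; rewrite lee_fin (le_trans (fg x))// ler_norm.
Qed.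

Lemma ge0_integral_shift (g : R -> R) (h : R) :
  continuous g -> (forall x, 0 <= g x) ->
  (\int[mu]_x (g (x + h))%:E = \int[mu]_x (g x)%:E)%E.
Proof.
move=> cg g0; apply/esym.
pose F (x : R) := x + h.
have dF (x : R) : is_derive x 1 F 1.
  have -> : F = (fun y => 1 * y + h) by apply/funext => y; rewrite mul1r.
  exact: is_derive1_affine.
have F' : F^`()%classic = cst 1.
  by apply/funext => x; rewrite derive1E; apply: derive_val.
rewrite (@increasing_ge0_integration_by_substitutionT _ F)//.
- by apply: eq_integral => x _; rewrite F' /= mulr1.
- by move=> x y xy; rewrite /F ltrD2r.
- by rewrite F' => x; exact: cvg_cst.
- by rewrite F'; exact: is_cvg_cst.
- by rewrite F'; exact: is_cvg_cst.
- exact: cvg_addrr_Ny.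
- exact: cvg_addrr.
Qed.

Lemma integrable_shift (g : R -> R) (h : R) :
  continuous g -> mu.-integrable [set: R] (EFin \o g) ->
  mu.-integrable [set: R] (EFin \o (fun x => g (x + h))).
Proof.
move=> cg /integrableP[mg ig].
have cgh : continuous (fun x => g (x + h)).
  move=> x; apply: (@continuous_comp _ _ _ (fun x => x + h) g); last exact: cg.
  by apply: (@cvgD _ R^o); [exact: cvg_id|exact: cvg_cst].
apply/integrableP; split.
  by apply/measurable_EFinP; exact: continuous_measurable_fun.
have ng : continuous (fun x => `|g x|).
  by move=> x; apply: continuous_comp; [exact: cg|exact: norm_continuous].
suff -> : (\int[mu]_x `|(EFin \o (fun x : R => (g (x + h)%R))) x| =
  \int[mu]_x `|(EFin \o g) x|)%E by exact: ig.
exact: (ge0_integral_shift h ng (fun=> normr_ge0 _)).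
Qed.

(** Reduced to the nonnegative case: a signed [g] is the difference of
    [g + |g|] and [|g|]. *)
Lemma Rintegral_shift (g : R -> R) (h : R) :
  continuous g -> mu.-integrable [set: R] (EFin \o g) ->
  \int[mu]_x g (x + h) = \int[mu]_x g x.
Proof.
move=> cg ig.
have ng : continuous (fun x => `|g x|).
  by move=> x; apply: continuous_comp; [exact: cg|exact: norm_continuous].
have ing : mu.-integrable [set: R] (EFin \o (fun x => `|g x|)).
  exact: integrable_norm.
have cgg : continuous (fun x => g x + `|g x|).
  by move=> x; apply: (@cvgD _ R^o); [exact: cg|exact: ng].
have -> : \int[mu]_x g (x + h) =
    \int[mu]_x ((g (x + h) + `|g (x + h)|) - `|g (x + h)|).
  by apply: eq_Rintegral => x _; rewrite addrK.
have -> : \int[mu]_x g x = \int[mu]_x ((g x + `|g x|) - `|g x|).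
  by apply: eq_Rintegral => x _; rewrite addrK.
have igg : mu.-integrable [set: R] (EFin \o (fun x => g x + `|g x|)).
  by rewrite (_ : _ \o _ = (EFin \o g) \+ (EFin \o (fun x => `|g x|)))//; exact: integrableD.
rewrite !RintegralB//.
- congr (fine _ - fine _).
    apply: (@ge0_integral_shift (fun x => g x + `|g x|)) => // x.
    by rewrite -lerBlDr sub0r lerNl -normrN ler_norm.
  exact: (@ge0_integral_shift (fun x => `|g x|)).
- exact: (@integrable_shift (fun x => g x + `|g x|)).
- exact: (@integrable_shift (fun x => `|g x|)).
Qed.

End real_calculus.

(** * Gaussian integrals and the Fourier transform of a Gaussian *)

Section gaussian_integrals.
Context {R : realType}.
Notation mu := (@lebesgue_measure R).
Implicit Types al s b x y m : R.

Lemma integral_gaussian al m : 0 < al ->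
  (\int[mu]_x (expR (- (al * (x - m) ^+ 2)))%:E = (Num.sqrt (pi / al))%:E)%E.
Proof.
move=> al0; pose sg := (Num.sqrt (2 * al))^-1.
have sg2 : sg ^+ 2 = (2 * al)^-1 by rewrite exprVn sqr_sqrtr// ltW// mulr_gt0.
have sg0 : sg != 0 by rewrite invr_eq0 gt_eqF// sqrtr_gt0 mulr_gt0.
have pk : normal_peak sg = (Num.sqrt (pi / al))^-1.
  congr (Num.sqrt _)^-1; rewrite sg2 -mulr_natl.
  by field; rewrite gt_eqF.
have : (\int[mu]_x ((Num.sqrt (pi / al))%:E * (normal_pdf m sg x)%:E) =
    (Num.sqrt (pi / al))%:E)%E.
  rewrite ge0_integralZl//.
  - by rewrite integral_normal_pdf mule1.
  - by apply/measurable_EFinP; exact: measurable_normal_pdf.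
  - by move=> x _; rewrite lee_fin normal_pdf_ge0.
move=> <-; apply: eq_integral => x _; rewrite -EFinM; congr EFin.
rewrite normal_pdfE// pk mulVKf ?gt_eqF ?sqrtr_gt0 ?divr_gt0 ?pi_gt0//.
congr expR; rewrite sg2 -mulr_natl.
by field; rewrite gt_eqF.
Qed.

Lemma continuous_gaussian al m : continuous (fun x : R => expR (- (al * (x - m) ^+ 2))).
Proof.
move=> x; apply: (@continuous_comp _ _ _ (fun x : R => - (al * (x - m) ^+ 2)) expR);
  last exact: continuous_expR.
apply: (@cvgN _ R^o); apply: cvgM; first exact: cvg_cst.
apply: (@continuous_comp _ _ _ (fun x : R => x - m) (fun x : R => x ^+ 2));
  last exact: sqr_continuous.
by apply: (@cvgB _ R^o); [exact: cvg_id|exact: cvg_cst].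
Qed.

Lemma integrable_gaussian al m : 0 < al ->
  mu.-integrable [set: R] (EFin \o (fun x : R => expR (- (al * (x - m) ^+ 2)))).
Proof.
move=> al0; apply/integrableP; split.
  apply/measurable_EFinP; apply: continuous_measurable_fun.
  exact: continuous_gaussian.
under eq_integral do rewrite /= ger0_norm ?expR_ge0//.
by rewrite integral_gaussian// ltry.
Qed.

Lemma Rintegral_gaussian al m : 0 < al ->
  \int[mu]_x expR (- (al * (x - m) ^+ 2)) = Num.sqrt (pi / al).
Proof. by move=> al0; rewrite /Rintegral integral_gaussian. Qed.

(** Half of the exponent absorbs the factor [|x|], since [e^u >= 1 + u]. *)
Lemma gaussian_moment_le al x : 0 < al ->
  `|x| * expR (- (al * x ^+ 2)) <=
  (1 + 2 / al) * expR (- (al / 2 * x ^+ 2)).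
Proof.
move=> al0.
have -> : - (al * x ^+ 2) = - (al / 2 * x ^+ 2) - al / 2 * x ^+ 2 by lra.
rewrite expRD mulrA ler_wpM2r ?expR_ge0// expRN ler_pdivrMr ?expR_gt0//.
have h := expR_ge1Dx (al / 2 * x ^+ 2).
have h1 : `|x| <= 1 + x ^+ 2.
  by rewrite -(real_normK (num_real x)); have := normr_ge0 x; nra.
apply: (le_trans h1); set e := expR _ in h *.
have e1 : 1 <= e by rewrite (le_trans _ h)// lerDl mulr_ge0 ?sqr_ge0// divr_ge0// ltW.
rewrite mulrDl mul1r lerD//.
rewrite mulrAC ler_pdivlMr// mulrC.
by have := sqr_ge0 x; lra.
Qed.

(** Uniform in [|h| <= 1], as domination under the integral sign requires;
    it rests on [(x + h)^2 >= x^2 / 2 - h^2]. *)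
Lemma gaussian_shift_le al x h : 0 < al -> `|h| <= 1 ->
  expR (- (al * (x + h) ^+ 2)) <= expR al * expR (- (al / 2 * x ^+ 2)).
Proof.
move=> al0; rewrite ler_norml => /andP[h1 h2].
rewrite -expRD ler_expR.
have : (x + h) ^+ 2 >= x ^+ 2 / 2 - 1 by have := sqr_ge0 (x + 2 * h); nra.
by nra.
Qed.

End gaussian_integrals.

Section gaussian_fourier.
Context {R : realType}.
Notation mu := (@lebesgue_measure R).
Implicit Types al s b x y m : R.

Lemma is_derive_gaussian al x :
  is_derive x 1 (fun y : R => expR (- (al * y ^+ 2)))
    (- (2 * al * x) * expR (- (al * x ^+ 2))).
Proof.
have h1 : is_derive x 1 (fun y : R => - al * y ^+ 2) (0 * x ^+ 2 + - al * (2 * x)).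
  exact: (is_derive1M (is_derive_cst (- al) x 1) (is_derive1_sqr x)).
have h2 := is_derive1_comp_fun (g := fun y => - al * y ^+ 2) (is_derive_expR _) h1.
have -> : (fun y : R => expR (- (al * y ^+ 2))) = (fun y : R => expR (- al * y ^+ 2)).
  by apply/funext => y; rewrite mulNr.
by apply: is_derive_eq h2 _; rewrite mulNr; ring.
Qed.

Lemma is_derive_sin_affine s b x :
  is_derive x 1 (fun y : R => sin (s * y + b)) (s * cos (s * x + b)).
Proof.
have h := is_derive1_comp_fun (g := fun y => s * y + b) (is_derive_sin _)
  (is_derive1_affine s b x).
by apply: is_derive_eq h _; rewrite mulrC.
Qed.

Lemma is_derive_cos_affine s b x :
  is_derive x 1 (fun y : R => cos (s * y + b)) (- s * sin (s * x + b)).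
Proof.
have h := is_derive1_comp_fun (g := fun y => s * y + b) (is_derive_cos _)
  (is_derive1_affine s b x).
by apply: is_derive_eq h _; rewrite mulrC mulrN mulNr.
Qed.

Lemma integrable_gaussian0 al : 0 < al ->
  mu.-integrable [set: R] (EFin \o (fun x : R => expR (- (al * x ^+ 2)))).
Proof.
move=> al0; have := integrable_gaussian 0 al0.
by under [X in _.-integrable _ (EFin \o X)]eq_fun do rewrite subr0.
Qed.

Lemma integrable_gaussianZ al (c : R) : 0 < al ->
  mu.-integrable [set: R] (EFin \o (fun x : R => c * expR (- (al * x ^+ 2)))).
Proof.
by move=> al0; apply: integrable_scale; exact: integrable_gaussian0.
Qed.

Lemma continuous_sin_gaussian al s b :
  continuous (fun x : R => sin (s * x + b) * expR (- (al * x ^+ 2))).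
Proof.
exact: is_derive1_continuous.
Qed.

Lemma continuous_cos_gaussian al s b :
  continuous (fun x : R => cos (s * x + b) * expR (- (al * x ^+ 2))).
Proof.
exact: is_derive1_continuous.
Qed.

Lemma integrable_cos_gaussian al s b : 0 < al ->
  mu.-integrable [set: R]
    (EFin \o (fun x : R => cos (s * x + b) * expR (- (al * x ^+ 2)))).
Proof.
move=> al0; apply: (continuous_integrable_le _ _ (integrable_gaussian0 al0)).
  exact: continuous_cos_gaussian.
move=> x; rewrite normrM [X in _ * X]ger0_norm ?expR_ge0// ler_piMl ?expR_ge0//.
exact: cos_max.
Qed.

Lemma integrable_sin_gaussian al s b : 0 < al ->
  mu.-integrable [set: R]
    (EFin \o (fun x : R => sin (s * x + b) * expR (- (al * x ^+ 2)))).
Proof.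
move=> al0; apply: (continuous_integrable_le _ _ (integrable_gaussian0 al0)).
  exact: continuous_sin_gaussian.
move=> x; rewrite normrM [X in _ * X]ger0_norm ?expR_ge0// ler_piMl ?expR_ge0//.
exact: sin_max.
Qed.

Lemma continuous_moment_gaussian al s b :
  continuous (fun x : R => x * sin (s * x + b) * expR (- (al * x ^+ 2))).
Proof.
exact: is_derive1_continuous.
Qed.

Lemma integrable_moment_gaussian al s b : 0 < al ->
  mu.-integrable [set: R]
    (EFin \o (fun x : R => x * sin (s * x + b) * expR (- (al * x ^+ 2)))).
Proof.
move=> al0; have al20 : 0 < al / 2 by rewrite divr_gt0.
apply: (continuous_integrable_le _ _ (integrable_gaussianZ (1 + 2 / al) al20)).
  exact: continuous_moment_gaussian.
move=> x; apply: le_trans (gaussian_moment_le x al0).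
rewrite !normrM [X in _ * X]ger0_norm ?expR_ge0// ler_wpM2r ?expR_ge0//.
by rewrite ler_piMr// sin_max.
Qed.

(** Integration by parts: the integral of the derivative [q'] of
    [q y = sin (s y + b) e^(- al y^2)] vanishes. Instead of boundary terms, the
    proof uses that the integral of [q (x + h)] does not depend on [h] and
    differentiates it at [h = 0]. *)
Lemma integral_moment_sin_gaussian al s b : 0 < al ->
  2 * al * \int[mu]_x (x * sin (s * x + b) * expR (- (al * x ^+ 2))) =
  s * \int[mu]_x (cos (s * x + b) * expR (- (al * x ^+ 2))).
Proof.
move=> al0; have al20 : 0 < al / 2 by rewrite divr_gt0.
have al40 : 0 < al / 2 / 2 by rewrite divr_gt0.
pose q (y : R) := sin (s * y + b) * expR (- (al * y ^+ 2)).
pose q' (y : R) := s * (cos (s * y + b) * expR (- (al * y ^+ 2))) -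
  2 * al * (y * sin (s * y + b) * expR (- (al * y ^+ 2))).
have dq (y : R) : is_derive y 1 q (q' y).
  have h := is_derive1M (is_derive_sin_affine s b y) (is_derive_gaussian al y).
  by apply: is_derive_eq h _; rewrite /q'; ring.
have cq : continuous q by exact: continuous_sin_gaussian.
have iq : mu.-integrable [set: R] (EFin \o q) by exact: integrable_sin_gaussian.
pose C : R := `|s| + 2 * al * (1 + 2 / al).
have q'le y : `|q' y| <= C * expR (- (al / 2 * y ^+ 2)).
  have c1 := cos_max (s * y + b); have s1 := sin_max (s * y + b).
  rewrite (le_trans (ler_normB _ _))// /C [leRHS]mulrDl lerD//.
    rewrite normrM ler_wpM2l// normrM [X in _ * X]ger0_norm ?expR_ge0//.
    apply: (@le_trans _ _ (1 * expR (- (al * y ^+ 2)))).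
      by rewrite ler_wpM2r ?expR_ge0.
    by rewrite mul1r ler_expR lerN2; have := sqr_ge0 y; nra.
  have al2 : 0 < 2 * al by rewrite mulr_gt0.
  rewrite normrM (gtr0_norm al2) -[leRHS]mulrA ler_pM2l//.
  apply: le_trans (gaussian_moment_le y al0).
  rewrite !normrM [X in _ * X]ger0_norm ?expR_ge0// ler_wpM2r ?expR_ge0//.
  by rewrite ler_piMr.
have C0 : 0 <= C by rewrite addr_ge0// mulr_ge0// ?mulr_ge0 ?addr_ge0 ?divr_ge0 ?ltW.
have dI : is_derive (0 : R) 1 (fun h => \int[mu]_x q (x + h)) (\int[mu]_x q' (x + 0)).
  apply: (@is_derive_integral _ (fun h x => q (x + h)) (fun h x => q' (x + h))
    (fun x => C * expR (al / 2) * expR (- (al / 2 / 2 * x ^+ 2)))).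
  - by move=> h; exact: integrable_shift.
  - move=> h y.
    have h1 := is_derive1_comp_fun (g := fun h => 1 * h + y) (dq _) (is_derive1_affine 1 y h).
    rewrite (_ : (fun h => q (y + h)) = (fun h => q (1 * h + y))); last first.
      by apply/funext => z; rewrite mul1r addrC.
    by apply: is_derive_eq h1 _; rewrite mulr1 mul1r addrC.
  - by move=> y; rewrite !mulr_ge0 ?expR_ge0.
  - exact: integrable_gaussianZ.
  - move=> h y; rewrite subr0 => /ltW h1; rewrite (le_trans (q'le _))// -[leRHS]mulrA.
    by rewrite ler_wpM2l// gaussian_shift_le.
have e0 : \int[mu]_x q' (x + 0) = 0.
  rewrite (_ : (fun h => _) = cst (\int[mu]_x q x)) in dI; last first.
    by apply/funext => h; exact: Rintegral_shift.
  by rewrite -(@derive_val _ _ _ _ _ _ _ dI) derive_cst.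
have e1 : \int[mu]_x q' (x + 0) = \int[mu]_x q' x.
  by apply: eq_Rintegral => x _; rewrite addr0.
move: e0; rewrite e1 /q' RintegralB//.
- rewrite !RintegralZl//.
  + by move/eqP; rewrite subr_eq0 => /eqP ->.
  + exact: integrable_moment_gaussian.
  + exact: integrable_cos_gaussian.
- by apply: integrable_scale; exact: integrable_cos_gaussian.
- by apply: integrable_scale; exact: integrable_moment_gaussian.
Qed.

(** As a function of [s] the integral [J] solves [J' = - s / (2 al) J], by
    differentiation under the integral sign and integration by parts; hence
    [J s * e^(s^2 / (4 al))] is constant. The phase [b] covers cosine and sine
    transforms at once. *)
Lemma gaussian_fourier al s b : 0 < al ->
  \int[mu]_x (cos (s * x + b) * expR (- (al * x ^+ 2))) =
  cos b * Num.sqrt (pi / al) * expR (- (s ^+ 2 / (4 * al))).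
Proof.
move=> al0; have al20 : 0 < al / 2 by rewrite divr_gt0.
pose J (s : R) := \int[mu]_x (cos (s * x + b) * expR (- (al * x ^+ 2))).
have dJ (u : R) : is_derive u 1 J (- (u / (2 * al)) * J u).
  have h : is_derive u 1 J
      (\int[mu]_x (- 1 * (x * sin (u * x + b) * expR (- (al * x ^+ 2))))).
    apply: (@is_derive_integral _ (fun v x => cos (v * x + b) * expR (- (al * x ^+ 2)))
      (fun v x => - 1 * (x * sin (v * x + b) * expR (- (al * x ^+ 2))))
      (fun x => (1 + 2 / al) * expR (- (al / 2 * x ^+ 2)))).
    - by move=> v; exact: integrable_cos_gaussian.
    - move=> v y; have h := is_derive1M (is_derive_cos_affine y b v)
        (is_derive_cst (expR (- (al * y ^+ 2))) v 1).
      rewrite (_ : (fun v => _) = (fun v => cos (y * v + b) * expR (- (al * y ^+ 2)))); last first.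
        by apply/funext => z; rewrite mulrC [z * y]mulrC mulrC.
      by apply: is_derive_eq h _; rewrite /= [v * y]mulrC; ring.
    - by move=> y; rewrite mulr_ge0 ?expR_ge0// addr_ge0// divr_ge0// ltW.
    - exact: integrable_gaussianZ.
    - move=> v y _; apply: le_trans (gaussian_moment_le y al0).
      rewrite mulN1r normrN !normrM [X in _ * X]ger0_norm ?expR_ge0//.
      by rewrite ler_wpM2r ?expR_ge0// ler_piMr// sin_max.
  apply: is_derive_eq h _; rewrite RintegralZl//; last exact: integrable_moment_gaussian.
  have := integral_moment_sin_gaussian u b al0; rewrite -/(J u).
  set I := \int[mu]_x _ => e.
  have -> : - (u / (2 * al)) * J u = - (u * J u / (2 * al)) by ring.
  by rewrite -e; field; rewrite gt_eqF.
pose Phi (u : R) := J u * expR (- (- (4 * al)^-1 * u ^+ 2)).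
have dPhi (u : R) : is_derive u 1 Phi 0.
  have h := is_derive1M (dJ u) (is_derive_gaussian (- (4 * al)^-1) u).
  apply: is_derive_eq h _.
  have -> : - (2 * - (4 * al)^-1 * u) = u / (2 * al).
    by field; rewrite gt_eqF.
  by ring.
have := is_derive_0_is_cst s 0 dPhi.
rewrite /Phi expr0n mulr0 oppr0 expR0 mulr1 mulNr opprK.
have -> : J 0 = cos b * Num.sqrt (pi / al).
  rewrite /J -(Rintegral_gaussian 0 al0) -RintegralZl//; last exact: integrable_gaussian.
  by apply: eq_Rintegral => x _; rewrite mul0r add0r subr0.
move=> <-; rewrite -/(J s) -mulrA -expRD [s ^+ 2 / _]mulrC addrN expR0 mulr1 //.
Qed.

End gaussian_fourier.

(** * Fubini for real-valued integrals, and laws with a density *)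

(** The bound [h], whose sections have integrals dominated by [g], provides
    integrability on the product; integrability of every section makes the
    inner integrals real numbers. *)
Lemma Rintegral_fubini d1 d2 (T1 : measurableType d1) (T2 : measurableType d2)
    (R : realType) (m1 : {sigma_finite_measure set T1 -> \bar R})
    (m2 : {sigma_finite_measure set T2 -> \bar R}) (f : T1 -> T2 -> R)
    (g : T1 -> R) (h : T1 -> T2 -> R) :
  measurable_fun [set: T1 * T2] (fun z => f z.1 z.2) ->
  (forall x, m2.-integrable [set: T2] (EFin \o f x)) ->
  (forall y, m1.-integrable [set: T1] (EFin \o f ^~ y)) ->
  (forall x y, `|f x y| <= h x y) ->
  (forall x, m2.-integrable [set: T2] (EFin \o h x)) ->
  (forall x, \int[m2]_y h x y <= g x) ->
  m1.-integrable [set: T1] (EFin \o g) ->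
  measurable_fun [set: T2] (fun y => \int[m1]_x f x y) /\
  \int[m1]_x \int[m2]_y f x y = \int[m2]_y \int[m1]_x f x y.
Proof.
move=> mf if2 if1 fh ih hg ig.
have mef : measurable_fun [set: T1 * T2] (fun z : T1 * T2 => (f z.1 z.2)%:E).
  exact/measurable_EFinP.
have key : ((m1 \x m2)%E).-integrable [set: T1 * T2]
    (fun z : T1 * T2 => (f z.1 z.2)%:E).
  apply/integrable12ltyP => //=.
  apply: (@le_lt_trans _ _ (\int[m1]_x (g x)%:E)%E); last exact: integrable_lty.
  apply: ge0_le_integral => //.
  - by move=> x _; apply: integral_ge0.
  - apply: (measurable_fun_fubini_tonelli_F (fun z : T1 * T2 => `|(f z.1 z.2)%:E|%E)) => //.
    exact: measurableT_comp.
  - exact: (measurable_int _ ig).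
  move=> x _; rewrite (@le_trans _ _ (\int[m2]_y (h x y)%:E)%E)//.
    apply: ge0_le_integral => //.
    - exact: (measurable_int _ (integrable_norm (if2 x))).
    - exact: (measurable_int _ (ih x)).
    - by move=> y _; rewrite /= lee_fin.
  have := hg x; rewrite -lee_fin /Rintegral fineK//.
  by apply: integrable_fin_num => //; exact: ih.
have := Fubini key; rewrite /=.
have e1 : (fun x => (\int[m2]_y (f x y)%:E)%E) = (fun x => (\int[m2]_y f x y)%:E).
  by apply/funext => x; rewrite /Rintegral fineK//; apply: integrable_fin_num => //; exact: if2.
have e2 : (fun y => (\int[m1]_x (f x y)%:E)%E) = (fun y => (\int[m1]_x f x y)%:E).
  by apply/funext => y; rewrite /Rintegral fineK//; apply: integrable_fin_num => //; exact: if1.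
rewrite e1 e2 => e; split; last by have := congr1 fine e.
apply/measurable_EFinP; have := measurable_fubini_G key.
by rewrite /fubini_G /= e2.
Qed.

Section density.
Context d (T : measurableType d) (R : realType) (P : probability T R).
Notation mu := (@lebesgue_measure R).
Variables (X : T -> R) (p : R -> R).
Hypotheses (mX : measurable_fun [set: T] X) (pX : is_density P X p).

Lemma integral_density (f : R -> R) :
  measurable_fun [set: R] f -> (forall x, 0 <= f x) ->
  (\int[P]_w (f (X w))%:E = \int[mu]_x (p x * f x)%:E)%E.
Proof.
move=> mf f0; case: pX => mp p0 PX.
pose Y : {RV P >-> R} := HB.pack X (isMeasurableFun.Build _ _ _ _ X mX).
have := @ge0_integral_change_density _ _ _ _ _ mu (distribution P Y) p id 1 mp p0.
move=> ->//.
- rewrite mul1e ge0_integral_distribution//.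
  exact/measurable_EFinP.
- move=> B mB; rewrite mul1e.
  apply: eq_trans (esym (PX B mB)); rewrite [RHS]integral_mkcond.
  apply: eq_integral => x _; rewrite patchE indicE.
  by case: (x \in B); rewrite ?mulr1 ?mulr0.
Qed.

Lemma integrable_density : mu.-integrable [set: R] (EFin \o p).
Proof.
case: pX => mp p0 PX; apply/integrableP; split; first exact/measurable_EFinP.
under eq_integral do rewrite /= ger0_norm//.
rewrite -PX// (le_lt_trans (probability_le1 _ _)) ?ltry//.
by rewrite preimage_setT.
Qed.

Lemma bounded_integral_density (f : R -> R) (K : R) :
  measurable_fun [set: R] f -> (forall x, `|f x| <= K) ->
  mu.-integrable [set: R] (EFin \o (fun x => p x * f x)) /\
  \int[P]_w f (X w) = \int[mu]_x (p x * f x).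
Proof.
move=> mf fK; case: (pX) => mp p0 PX.
have K0 : 0 <= K by rewrite (le_trans _ (fK 0)).
have ip := integrable_density.
have ipf : mu.-integrable [set: R] (EFin \o (fun x => p x * f x)).
  apply: (le_integrable measurableT _ _ (integrable_scale K ip)).
    by apply/measurable_EFinP/measurable_funM.
  move=> x _ /=; rewrite lee_fin normrM [leRHS]normrM mulrC ler_wpM2r//.
  by rewrite (le_trans (fK x))// ler_norm.
split=> //.
have mfX : measurable_fun [set: T] (fun w => f (X w)) by exact: measurableT_comp.
have ifX : P.-integrable [set: T] (EFin \o (fun w => f (X w))).
  by apply: (@bounded_integrable _ _ _ P _ K mfX).
have fK0 x : 0 <= f x + K by have := fK x; rewrite ler_norml -lerBlDr sub0r => /andP[].
have mfK : measurable_fun [set: R] (fun x => f x + K) by exact: measurable_funD.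
have h := congr1 fine (integral_density mfK fK0).
have {h} : \int[P]_w (f (X w) + K) = \int[mu]_x (p x * f x + K * p x).
  by rewrite [LHS]h; apply: eq_Rintegral => x _; rewrite mulrDr [p x * K]mulrC.
rewrite !RintegralD//; last 2 first.
- exact: integrable_scale.
- exact: finite_measure_integrable_cst.
have PT : P [set: T] = 1%E by exact: probability_setT.
have -> : \int[P]__ K = K.
  by rewrite Rintegral_cst// (_ : fine _ = 1) ?mulr1//; exact: (congr1 fine PT).
rewrite RintegralZl//.
have -> : \int[mu]_x p x = 1.
  have := congr1 fine PT; rewrite -[X in P X](preimage_setT X) PX//.
by rewrite mulr1 => /addIr.
Qed.

End density.

(** * The characteristic function of a weighted noncentral chi-square sum *)

Section normal_square.
Context {R : realType}.
Notation mu := (@lebesgue_measure R).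
Implicit Types x y z w h th a : R.

Let phi : R -> R := normal_pdf 0 1.
Let c : R := (Num.sqrt (2 * pi))^-1.

Lemma standard_normal_pdfE x : normal_pdf 0 1 x = c * expR (- (2^-1 * x ^+ 2)).
Proof.
rewrite normal_pdfE ?oner_neq0// /normal_peak /normal_fun subr0 expr1n mul1r.
by rewrite -[pi *+ 2]mulr_natl -[1 *+ 2]/2 mulNr [x ^+ 2 / 2]mulrC.
Qed.

Let phi_ge0 x : 0 <= phi x. Proof. exact: normal_pdf_ge0. Qed.

Let phi_cont : continuous phi.
Proof. by apply: continuous_normal_pdf; exact: oner_neq0. Qed.

Let phi_int : mu.-integrable [set: R] (EFin \o phi).
Proof. exact: integrable_normal_pdf. Qed.

Let phi_int1 : \int[mu]_x phi x = 1.
Proof. by rewrite /Rintegral integral_normal_pdf. Qed.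

Let trig_int (f : R -> R) : continuous f -> (forall x, `|f x| <= 1) ->
  mu.-integrable [set: R] (EFin \o (fun x => phi x * f x)).
Proof.
move=> cf f1; apply: (continuous_integrable_le _ _ phi_int).
  by move=> x; apply: cvgM; [exact: phi_cont|exact: cf].
by move=> x; rewrite normrM ger0_norm// ler_piMr.
Qed.

Let B th a x := th * (x - a) ^+ 2.

Let B_cont th a : continuous (B th a).
Proof.
move=> x; apply: cvgM; first exact: cvg_cst.
apply: (@continuous_comp _ _ _ (fun x : R => x - a) (fun x : R => x ^+ 2));
  last exact: sqr_continuous.
by apply: (@cvgB _ R^o); [exact: cvg_id|exact: cvg_cst].
Qed.

Let cosB_cont th a b : continuous (fun x => cos (B th a x - b)).
Proof.
move=> x; apply: (@continuous_comp _ _ _ (fun x : R => B th a x - b) (@cos R));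
  last exact: continuous_cos.
by apply: (@cvgB _ R^o); [exact: B_cont|exact: cvg_cst].
Qed.

Let sinB_cont th a : continuous (fun x => sin (B th a x)).
Proof.
by move=> x; apply: (@continuous_comp _ _ _ (B th a) (@sin R));
  [exact: B_cont|exact: continuous_sin].
Qed.

(** Symmetrization: with an independent copy [Z'] of [Z],
    [|E e^(i th (Z - a)^2)|^2 = E cos (th ((Z - a)^2 - (Z' - a)^2))], and for
    [h = Z - Z'] and [v = (Z + Z') / 2] the argument of the cosine is bilinear,
    [2 th h (v - a)], while the Gaussian weight splits as
    [e^(- v^2) e^(- h^2 / 4)]. Integrating in [v] and then in [h] takes two real
    Gaussian Fourier transforms. *)
Lemma normal_square_modulus th a :
  (\int[mu]_x (normal_pdf 0 1 x * cos (th * (x - a) ^+ 2))) ^+ 2 +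
  (\int[mu]_x (normal_pdf 0 1 x * sin (th * (x - a) ^+ 2))) ^+ 2 =
  (Num.sqrt (1 + 4 * th ^+ 2))^-1 *
  expR (- (4 * th ^+ 2 * a ^+ 2 / (1 + 4 * th ^+ 2))).
Proof.
rewrite -/phi.
set C := \int[mu]_x _; set S := \int[mu]_x _.
have iC : mu.-integrable [set: R] (EFin \o (fun x => phi x * cos (B th a x))).
  apply: trig_int => x; last exact: cos_max.
  by have := @cosB_cont th a 0 x; under eq_fun do rewrite subr0.
have iS : mu.-integrable [set: R] (EFin \o (fun x => phi x * sin (B th a x))).
  by apply: trig_int => [|x]; [exact: sinB_cont|exact: sin_max].
(* [C^2 + S^2] as a double integral over two independent copies *)
have inner w : \int[mu]_z (phi z * cos (B th a z - B th a w)) =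
    cos (B th a w) * C + sin (B th a w) * S.
  rewrite -RintegralZl// -[X in _ + X]RintegralZl// -RintegralD//; first last.
  - exact: integrable_scale.
  - exact: integrable_scale.
  by apply: eq_Rintegral => z _; rewrite cosB; ring.
have -> : C ^+ 2 + S ^+ 2 =
    \int[mu]_w (phi w * \int[mu]_z (phi z * cos (B th a z - B th a w))).
  transitivity (\int[mu]_w (C * (phi w * cos (B th a w)) +
                            S * (phi w * sin (B th a w)))).
    rewrite RintegralD//; first last.
    - exact: integrable_scale.
    - exact: integrable_scale.
    by rewrite !RintegralZl// -/C -/S !expr2.
  by apply: eq_Rintegral => w _; rewrite inner; ring.
pose k w h := phi w * (phi (h + w) * cos (B th a (h + w) - B th a w)).
have kE w : phi w * \int[mu]_z (phi z * cos (B th a z - B th a w)) = \int[mu]_h k w h.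
  pose q z := phi z * cos (B th a z - B th a w).
  have cq : continuous q.
    by move=> z; apply: cvgM; [exact: phi_cont|exact: cosB_cont].
  have iq : mu.-integrable [set: R] (EFin \o q).
    by apply: trig_int => x; [exact: cosB_cont|exact: cos_max].
  rewrite -(Rintegral_shift w cq iq) -RintegralZl//.
  exact: integrable_shift.
under eq_Rintegral do rewrite kE.
have cphih w : continuous (fun h => phi (h + w)).
  move=> x; apply: (@continuous_comp _ _ _ (fun x => x + w) phi); last exact: phi_cont.
  by apply: (@cvgD _ R^o); [exact: cvg_id|exact: cvg_cst].
have iphih w : mu.-integrable [set: R] (EFin \o (fun h => phi (h + w))).
  exact: integrable_shift.
have mphi : measurable_fun [set: R] phi by exact: measurable_normal_pdf.
have mB : measurable_fun [set: R] (B th a).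
  exact: continuous_measurable_fun.
have mcos := @measurable_cos R.
have mk : measurable_fun [set: R * R] (fun z : R * R => k z.1 z.2).
  have madd : measurable_fun [set: R * R] (fun z : R * R => z.2 + z.1).
    by apply: measurable_funD; [exact: measurable_snd|exact: measurable_fst].
  apply: measurable_funM; first by apply: measurableT_comp => //; exact: measurable_fst.
  apply: measurable_funM; first exact: measurableT_comp.
  apply: measurableT_comp => //; apply: measurable_funB; first exact: measurableT_comp.
  by apply: measurableT_comp => //; exact: measurable_fst.
have kle w h : `|k w h| <= phi w * phi (h + w).
  rewrite normrM ger0_norm// ler_wpM2l// normrM ger0_norm//.
  by rewrite ler_piMr// cos_max.
have ik2 w : mu.-integrable [set: R] (EFin \o k w).
  apply: (@le_integrable _ _ _ mu _ measurableT _ (EFin \o (fun h => phi w * phi (h + w)))).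
  - apply/measurable_EFinP.
    exact: (measurable_comp measurableT _ mk (measurable_pair1 w)).
  - move=> h _; rewrite /= lee_fin (le_trans (kle w h))//.
    exact: ler_norm.
  - exact: integrable_scale.
have ik1 h : mu.-integrable [set: R] (EFin \o (k ^~ h)).
  apply: (@le_integrable _ _ _ mu _ measurableT _ (EFin \o (fun w => normal_peak 1 * phi w))).
  - apply/measurable_EFinP.
    exact: (measurable_comp measurableT _ mk (measurable_pair2 h)).
  - move=> w _; rewrite /= lee_fin (le_trans (kle w h))//.
    rewrite ger0_norm ?mulr_ge0 ?normal_peak_ge0// mulrC ler_wpM2r//.
    by apply: normal_pdf_ub; exact: oner_neq0.
  - exact: integrable_scale.
have ih w : mu.-integrable [set: R] (EFin \o (fun h => phi w * phi (h + w))).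
  exact: integrable_scale.
have hle w : \int[mu]_h (phi w * phi (h + w)) <= phi w.
  by rewrite RintegralZl// Rintegral_shift// phi_int1 mulr1.
have [_ ->] := @Rintegral_fubini _ _ _ _ _ mu mu k _ _ mk ik2 ik1 kle ih hle phi_int.
(* the shift [v = w + h / 2] centres the Gaussian weight in [w] *)
have kint h : \int[mu]_w k w h =
    c ^+ 2 * Num.sqrt pi *
    (cos (2 * th * a * h + 0) * expR (- ((th ^+ 2 + 4^-1) * h ^+ 2))).
  pose g v := cos (2 * th * h * v + - (2 * th * h * a)) * expR (- (1 * v ^+ 2)).
  have cg : continuous g by exact: continuous_cos_gaussian.
  have ig : mu.-integrable [set: R] (EFin \o g) by exact: integrable_cos_gaussian.
  transitivity (\int[mu]_w (c ^+ 2 * expR (- (4^-1 * h ^+ 2)) * g (w + h / 2))).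
    apply: eq_Rintegral => w _; rewrite /k /phi !standard_normal_pdfE /g.
    have -> : B th a (h + w) - B th a w = 2 * th * h * (w + h / 2) + - (2 * th * h * a).
      by rewrite /B; field.
    set cc := cos _.
    transitivity (c ^+ 2 * cc *
        (expR (- (2^-1 * w ^+ 2)) * expR (- (2^-1 * (h + w) ^+ 2)))).
      by ring.
    transitivity (c ^+ 2 * cc *
        (expR (- (4^-1 * h ^+ 2)) * expR (- (1 * (w + h / 2) ^+ 2)))); last by ring.
    by congr *%R; rewrite -!expRD; congr expR; field.
  rewrite RintegralZl//; last exact: integrable_shift.
  rewrite Rintegral_shift// /g gaussian_fourier// divr1 cosN addr0.
  have -> : 2 * th * h * a = 2 * th * a * h by ring.
  have -> : - ((th ^+ 2 + 4^-1) * h ^+ 2) =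
    - (4^-1 * h ^+ 2) - (2 * th * h) ^+ 2 / (4 * 1) by field.
  by rewrite expRD; ring.
under eq_Rintegral do rewrite kint.
have u0 : 0 < th ^+ 2 + 4^-1 by rewrite ltr_wpDl// sqr_ge0.
rewrite RintegralZl//; last exact: integrable_cos_gaussian.
rewrite gaussian_fourier// cos0 mul1r.
have p0 : 0 < (pi : R) by exact: pi_gt0.
have sp0 : 0 < Num.sqrt (pi : R) by rewrite sqrtr_gt0.
have e1 : c ^+ 2 = (2 * pi)^-1 by rewrite /c exprVn sqr_sqrtr// mulr_ge0// ltW.
have e2 : 1 + 4 * th ^+ 2 = 2 ^+ 2 * (th ^+ 2 + 4^-1) by field.
have e3 : Num.sqrt (1 + 4 * th ^+ 2) = 2 * Num.sqrt (th ^+ 2 + 4^-1).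
  by rewrite e2 sqrtrM ?exprn_ge0// sqrtr_sqr ger0_norm.
rewrite mulrA; congr *%R.
  rewrite e3 e1 sqrtrM ?ltW// sqrtrV ?ltW//.
  rewrite -mulrA [X in _ * X]mulrA -expr2 sqr_sqrtr ?ltW//.
  have su0 : 0 < Num.sqrt (th ^+ 2 + 4^-1) by rewrite sqrtr_gt0.
  have pn : (pi : R) != 0 by rewrite gt_eqF.
  have un := lt0r_neq0 su0.
  by rewrite !invfM mulrA; congr *%R; rewrite -mulrA mulVf// mulr1.
congr expR; rewrite e2; field.
by rewrite gt_eqF//=; lra.
Qed.

End normal_square.

Section trig_sum.
Context d (T : measurableType d) (R : realType) (P : probability T R).
Context (n : nat) (Z : 'I_n -> {RV P >-> R}).
Hypothesis Zind : mutually_independent Z.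
Variable x : 'I_n -> R -> R.
Hypothesis mx : forall k, measurable_fun [set: R] (x k).

Let Ck k := \int[P]_w cos (x k (Z k w)).
Let Sk k := \int[P]_w sin (x k (Z k w)).

(* The pair [u] is the product of the complex numbers [Ck k + i Sk k], [k] in
   [s]. The factors outside [s] stay arbitrary bounded functions so that the
   addition formulas for [cos] and [sin] can turn the head of the list into one
   more factor. *)
Let trig_partial_sum (s : seq 'I_n) : uniq s ->
  exists u : R * R, u.1 ^+ 2 + u.2 ^+ 2 = \prod_(k <- s) (Ck k ^+ 2 + Sk k ^+ 2) /\
  forall f : 'I_n -> R -> R, (forall k, measurable_fun [set: R] (f k)) ->
    (forall k y, `|f k y| <= 1) ->
    \int[P]_w ((\prod_(k | k \notin s) f k (Z k w)) *
               cos (\sum_(k <- s) x k (Z k w))) =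
      u.1 * \prod_(k | k \notin s) \int[P]_w f k (Z k w) /\
    \int[P]_w ((\prod_(k | k \notin s) f k (Z k w)) *
               sin (\sum_(k <- s) x k (Z k w))) =
      u.2 * \prod_(k | k \notin s) \int[P]_w f k (Z k w).
Proof.
elim: s => [_|j s IH /= /andP[js us]].
  exists (1, 0); split; first by rewrite big_nil /= expr1n expr0n addr0.
  move=> f mf f1; rewrite /= mul1r mul0r; split; last first.
    under eq_Rintegral do rewrite big_nil sin0 mulr0.
    by rewrite Rintegral_cst// mul0r.
  under eq_Rintegral do rewrite big_nil cos0 mulr1.
  exact: (bounded_integral_prod_indep Zind mf f1).
have [[c e] /= [ce H]] := IH us.
exists (c * Ck j - e * Sk j, e * Ck j + c * Sk j); split.
  by rewrite /= big_cons -ce; ring.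
move=> f mf f1.
pose g (u : R -> R) (k : 'I_n) := if k == j then u else f k.
have mg u : measurable_fun [set: R] u -> forall k, measurable_fun [set: R] (g u k).
  by move=> mu k; rewrite /g; case: eqP.
have g1 u : (forall y, `|u y| <= 1) -> forall k y, `|g u k y| <= 1.
  by move=> u1 k y; rewrite /g; case: eqP.
have gE u (F : (R -> R) -> 'I_n -> R) : \prod_(k | k \notin s) F (g u k) k =
    F u j * \prod_(k | k \notin j :: s) F (f k) k.
  rewrite (bigD1 j)//= {1}/g eqxx; congr *%R.
  apply: eq_big => [k|k /andP[_ kj]]; first by rewrite inE negb_or andbC.
  by rewrite /g (negbTE kj).
have mcx : measurable_fun [set: R] (fun y => cos (x j y)).
  exact: (measurableT_comp (@measurable_cos R)).
have msx : measurable_fun [set: R] (fun y => sin (x j y)).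
  exact: (measurableT_comp (@measurable_sin R)).
have cx1 y : `|cos (x j y)| <= 1 by exact: cos_max.
have sx1 y : `|sin (x j y)| <= 1 by exact: sin_max.
have [cc cs] := H _ (mg _ mcx) (g1 _ cx1).
have [sc ss] := H _ (mg _ msx) (g1 _ sx1).
pose F w := \prod_(k | k \notin j :: s) f k (Z k w).
pose Sg w := \sum_(k <- s) x k (Z k w).
pose I := \prod_(k | k \notin j :: s) \int[P]_w f k (Z k w).
have gI u : \prod_(k | k \notin s) \int[P]_w g u k (Z k w) = \int[P]_w u (Z j w) * I.
  exact: (gE u (fun h k => \int[P]_w h (Z k w))).
have gF u w : \prod_(k | k \notin s) g u k (Z k w) = u (Z j w) * F w.
  exact: (gE u (fun h k => h (Z k w))).
rewrite gI -/(Ck j) in cc; rewrite gI -/(Ck j) in cs.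
rewrite gI -/(Sk j) in sc; rewrite gI -/(Sk j) in ss.
have mF : measurable_fun [set: T] F.
  rewrite /F; under eq_fun do rewrite -big_filter.
  by apply: measurable_prod => k _; apply: measurableT_comp.
have F1 w : `|F w| <= 1.
  by rewrite normr_prod prodr_ile1// => k _; rewrite normr_ge0 f1.
have mSg : measurable_fun [set: T] Sg.
  by apply: measurable_sum => k; apply: measurableT_comp.
have int4 (u v : R -> R) : measurable_fun [set: R] u -> measurable_fun [set: R] v ->
    (forall y, `|u y| <= 1) -> (forall y, `|v y| <= 1) ->
    P.-integrable [set: T] (EFin \o (fun w => (u (Z j w) * F w) * v (Sg w))).
  move=> mu mv u1 v1; apply: (@bounded_integrable _ _ _ P _ 1).
    apply: measurable_funM; last by apply: measurableT_comp.
    by apply: measurable_funM => //; apply: measurableT_comp.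
  move=> w; rewrite !normrM mulr_ile1 ?mulr_ge0//.
  by rewrite mulr_ile1.
have gFi u (v : R -> R) : \int[P]_w ((\prod_(k | k \notin s) g u k (Z k w)) * v (Sg w)) =
    \int[P]_w (u (Z j w) * F w * v (Sg w)).
  by apply: eq_Rintegral => w _; rewrite gF.
rewrite (gFi _ cos) in cc; rewrite (gFi _ sin) in cs.
rewrite (gFi _ cos) in sc; rewrite (gFi _ sin) in ss.
split => /=.
  transitivity (\int[P]_w (cos (x j (Z j w)) * F w * cos (Sg w) -
                           sin (x j (Z j w)) * F w * sin (Sg w))).
    by apply: eq_Rintegral => w _; rewrite big_cons cosD -/(F w) -/(Sg w); ring.
  rewrite RintegralB//; [|exact: (int4 (fun y => cos (x j y)) cos mcx
    (@measurable_cos R) cx1 (@cos_max R))|].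
    by rewrite cc ss -/I; ring.
  exact: (int4 (fun y => sin (x j y)) sin msx (@measurable_sin R) sx1 (@sin_max R)).
transitivity (\int[P]_w (sin (x j (Z j w)) * F w * cos (Sg w) +
                         cos (x j (Z j w)) * F w * sin (Sg w))).
  by apply: eq_Rintegral => w _; rewrite big_cons sinD -/(F w) -/(Sg w); ring.
rewrite RintegralD//; first by rewrite sc cs -/I; ring.
  exact: (int4 (fun y => sin (x j y)) cos msx (@measurable_cos R) sx1 (@cos_max R)).
exact: (int4 (fun y => cos (x j y)) sin mcx (@measurable_sin R) cx1 (@sin_max R)).
Qed.

(** Multiplicativity of the squared modulus of the characteristic function,
    without complex numbers. *)
Lemma charfun_modulus_sum_indep :
  (\int[P]_w cos (\sum_k x k (Z k w))) ^+ 2 +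
  (\int[P]_w sin (\sum_k x k (Z k w))) ^+ 2 =
  \prod_k ((\int[P]_w cos (x k (Z k w))) ^+ 2 +
           (\int[P]_w sin (x k (Z k w))) ^+ 2).
Proof.
have [[c e] /= [ce H]] := trig_partial_sum (index_enum_uniq 'I_n).
have [] := H (fun _ _ => 1) (fun _ => measurable_cst _) (fun _ _ => _).
  by rewrite normr1.
have e0 : (fun k : 'I_n => k \notin index_enum 'I_n) =1 xpred0.
  by move=> k; rewrite mem_index_enum.
under eq_Rintegral do rewrite (eq_bigl _ _ e0) big_pred0_eq mul1r.
under [in X in _ -> X -> _]eq_Rintegral do rewrite (eq_bigl _ _ e0) big_pred0_eq mul1r.
by rewrite (eq_bigl _ _ e0) big_pred0_eq !mulr1 => -> ->.
Qed.

End trig_sum.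

Section log_bounds.
Context {R : realType}.
Implicit Types s r v a : R.

Lemma ln1D_ge s : -1 < s -> s / (1 + s) <= ln (1 + s).
Proof.
move=> s1; have s0 : 0 < 1 + s by lra.
have : ln (1 + - (s / (1 + s))) <= - (s / (1 + s)).
  by apply: le_ln1Dx; rewrite ltrN2 ltr_pdivrMr//; lra.
have -> : 1 + - (s / (1 + s)) = (1 + s)^-1 by field; rewrite gt_eqF.
by rewrite lnV ?posrE// lerN2.
Qed.

(** Concavity of [ln] between [1] and [1 + v]. *)
Lemma ln1D_scale_ge r v : 0 <= r <= 1 -> 0 <= v ->
  r * ln (1 + v) <= ln (1 + r * v).
Proof.
move=> r01 v0.
have v1 : 0 < 1 + v by lra.
pose t : {i01 R} := Itv01 (proj1 (andP r01)) (proj2 (andP r01)).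
have := @concave_ln R t (1 + v) 1 v1 ltr01.
rewrite !convRE/= ln1 mulr0 addr0 /unstable.onem.
suff -> : r * (1 + v) + (1 - r) * 1 = 1 + r * v by [].
by ring.
Qed.

Lemma invsqrt_expR s : -1 < s -> (Num.sqrt (1 + s))^-1 = expR (- (2^-1 * ln (1 + s))).
Proof.
move=> s0; have s1 : 0 < 1 + s by lra.
rewrite expRN; congr (_^-1).
have e : expR (2^-1 * ln (1 + s)) ^+ 2 = 1 + s.
  rewrite -expRM_natl mulrA mulfV ?mul1r ?lnK ?posrE//.
by rewrite -[X in Num.sqrt X]e sqrtr_sqr ger0_norm ?expR_ge0.
Qed.

End log_bounds.

Section quadratic_form.
Context d (T : measurableType d) (R : realType) (P : probability T R).
Context (n : nat) (Z : 'I_n -> {RV P >-> R}).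
Hypothesis Znormal : forall k, standard_normal (Z k).
Hypothesis Zind : mutually_independent Z.
Variables lam a : 'I_n -> R.
Notation mu := (@lebesgue_measure R).

Lemma standard_normal_density (X : {RV P >-> R}) : standard_normal X ->
  is_density P X (normal_pdf 0 1).
Proof.
move=> nX; split.
- exact: measurable_normal_pdf.
- exact: normal_pdf_ge0.
- by move=> B mB; exact: nX.
Qed.

Lemma measurable_quad_form : measurable_fun [set: T] (quad_form_rv lam a Z).
Proof.
apply: measurable_sum => k; apply: measurable_funM; first exact: measurable_cst.
by apply: measurable_funX; apply: measurable_funB => //; exact: measurable_cst.
Qed.

Lemma charfun_quad_form_modulus (t : R) :
  (\int[P]_w cos (t * quad_form_rv lam a Z w)) ^+ 2 +
  (\int[P]_w sin (t * quad_form_rv lam a Z w)) ^+ 2 =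
  \prod_k ((Num.sqrt (1 + 4 * (t * lam k) ^+ 2))^-1 *
     expR (- (4 * (t * lam k) ^+ 2 * a k ^+ 2 / (1 + 4 * (t * lam k) ^+ 2)))).
Proof.
pose x (k : 'I_n) (y : R) := t * lam k * (y - a k) ^+ 2.
have mx k : measurable_fun [set: R] (x k).
  apply: measurable_funM; first exact: measurable_cst.
  by apply: measurable_funX; apply: measurable_funB => //; exact: measurable_cst.
have WE w : t * quad_form_rv lam a Z w = \sum_k x k (Z k w).
  by rewrite mulr_sumr; apply: eq_bigr => k _; rewrite /x mulrA.
under eq_Rintegral do rewrite WE.
under [in X in _ + X ^+ _]eq_Rintegral do rewrite WE.
rewrite charfun_modulus_sum_indep//; apply: eq_bigr => k _.
have mcos := @measurable_cos R; have msin := @measurable_sin R.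
have mZ : measurable_fun [set: T] (Z k) by [].
have dZ := standard_normal_density (Znormal k).
have [_ ->] := bounded_integral_density mZ dZ (measurableT_comp mcos (mx k))
  (fun y => cos_max (x k y)).
have [_ ->] := bounded_integral_density mZ dZ (measurableT_comp msin (mx k))
  (fun y => sin_max (x k y)).
exact: normal_square_modulus.
Qed.

(** With [s = 4 t^2 lam_k^2 <= 1] one has [ln (1 + s) >= s / (1 + s) >= s / 2],
    so each factor is at most a Gaussian in [t]. *)
Lemma charfun_modulus_small (t : R) : (forall k, 4 * (t * lam k) ^+ 2 <= 1) ->
  (\int[P]_w cos (t * quad_form_rv lam a Z w)) ^+ 2 +
  (\int[P]_w sin (t * quad_form_rv lam a Z w)) ^+ 2 <=
  expR (- (t ^+ 2 * (\sum_k lam k ^+ 2 + \sum_k lam k ^+ 2 * a k ^+ 2))).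
Proof.
move=> t1; rewrite charfun_quad_form_modulus -big_split/= mulr_sumr -sumrN expR_sum.
apply: ler_prod => k _; rewrite mulr_ge0 ?expR_ge0 ?invr_ge0//=.
set s := 4 * (t * lam k) ^+ 2.
have s0 : 0 <= s by rewrite mulr_ge0// sqr_ge0.
have s1 : s <= 1 by exact: t1.
rewrite invsqrt_expR; last by lra.
rewrite -expRD ler_expR.
have h1 : s / 2 <= s / (1 + s).
  by rewrite ler_wpM2l// lef_pV2 ?posrE; lra.
have h2 : s / (1 + s) <= ln (1 + s) by apply: ln1D_ge; lra.
have h3 : a k ^+ 2 * (s / 2) <= s * a k ^+ 2 / (1 + s).
  have -> : s * a k ^+ 2 / (1 + s) = a k ^+ 2 * (s / (1 + s)) by ring.
  by rewrite ler_wpM2l ?sqr_ge0.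
have h4 : 0 <= a k ^+ 2 * s by rewrite mulr_ge0 ?sqr_ge0.
have -> : t ^+ 2 * (lam k ^+ 2 + lam k ^+ 2 * a k ^+ 2) = s / 4 + a k ^+ 2 * s / 4.
  by rewrite /s; field.
by lra.
Qed.

(** Writing [s = r v] with [r = 3 lam_k^2 / A1], the condition on the [lam_k]
    says that [r <= 1], so [ln (1 + s) >= r ln (1 + v)]; the weights [r] sum to
    [3]. This gives a decay of order [|t|^(- 3 / 2)] for the modulus. The shifts
    contribute through [s / (1 + s) >= s / (2 v)]. *)
Lemma charfun_modulus_large (t : R) (A1 := \sum_k lam k ^+ 2)
    (B1 := \sum_k lam k ^+ 2 * a k ^+ 2) (v := 4 * A1 / 3 * t ^+ 2) :
  0 < A1 -> (forall k, lam k ^+ 2 <= A1 / 3) -> 1 <= v ->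
  (\int[P]_w cos (t * quad_form_rv lam a Z w)) ^+ 2 +
  (\int[P]_w sin (t * quad_form_rv lam a Z w)) ^+ 2 <=
  expR (- (3 / 2 * ln (1 + v) + 3 * B1 / (2 * A1))).
Proof.
move=> A0 lamA v1; rewrite charfun_quad_form_modulus.
have -> : 3 / 2 * ln (1 + v) + 3 * B1 / (2 * A1) =
    \sum_k (2^-1 * (3 * lam k ^+ 2 / A1 * ln (1 + v)) +
      3 * (lam k ^+ 2 * a k ^+ 2) / (2 * A1)).
  rewrite big_split/= -mulr_sumr -mulr_suml -mulr_suml -mulr_sumr -/A1.
  rewrite -mulr_suml -mulr_sumr -/B1; congr (_ + _).
  by field; rewrite gt_eqF.
rewrite -sumrN expR_sum.
apply: ler_prod => k _; rewrite mulr_ge0 ?expR_ge0 ?invr_ge0//=.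
set s := 4 * (t * lam k) ^+ 2.
have s0 : 0 <= s by rewrite mulr_ge0// sqr_ge0.
rewrite invsqrt_expR; last by lra.
rewrite -expRD ler_expR -opprD lerN2.
have sE : s = 3 * lam k ^+ 2 / A1 * v.
  by rewrite /s /v; field; rewrite gt_eqF.
have r01 : 0 <= 3 * lam k ^+ 2 / A1 <= 1.
  apply/andP; split; first by rewrite divr_ge0 ?(ltW A0)// mulr_ge0 ?sqr_ge0.
  rewrite ler_pdivrMr// mul1r.
  by have := lamA k; lra.
apply: lerD.
  by rewrite ler_pM2l// sE; apply: ln1D_scale_ge => //; lra.
have sv : s <= v by rewrite sE ler_piMl//; [lra|case/andP: r01].
have -> : s * a k ^+ 2 / (1 + s) = a k ^+ 2 * (s / (1 + s)) by ring.
have -> : 3 * (lam k ^+ 2 * a k ^+ 2) / (2 * A1) =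
    a k ^+ 2 * (3 * lam k ^+ 2 / A1 / 2) by field; rewrite gt_eqF.
rewrite ler_wpM2l ?sqr_ge0// ler_pdivlMr; last by lra.
rewrite {2}sE; set r := _ / A1 in r01 *.
have [r0 _] := andP r01.
have : r * (1 + s) <= r * (2 * v) by rewrite ler_wpM2l//; lra.
by lra.
Qed.

End quadratic_form.

(** * Upper bound for the density *)

Section dominating_function.
Context {R : realType}.
Notation mu := (@lebesgue_measure R).
Implicit Types t ka : R.

Let F ka t : R := - (2 / ka) * expR (- (2^-1 * ln (1 + ka * t))).

Let dF ka t : 0 < ka -> 0 <= t ->
  is_derive t 1 (F ka) (expR (- (3 / 2 * ln (1 + ka * t)))).
Proof.
move=> ka0 t0.
have u0 : 0 < 1 + ka * t by rewrite ltr_pwDl// mulr_ge0// ltW.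
have h0 := is_derive1_affine ka 1 t.
have u0' : 0 < ka * t + 1 by rewrite addrC.
have h1 := is_derive1_comp_fun (f := @ln R) (g := fun y => ka * y + 1) (x := t)
  (is_derive1_ln u0') h0.
have h2 := is_derive1M (is_derive_cst (- 2^-1 : R) t 1) h1.
have h3 := is_derive1_comp_fun (g := fun y => - 2^-1 * ln (ka * y + 1)) (is_derive_expR _) h2.
have h4 := is_derive1M (is_derive_cst (- (2 / ka) : R) t 1) h3.
rewrite (_ : F ka = fun y => - (2 / ka) * expR (- 2^-1 * ln (ka * y + 1))); last first.
  by apply/funext => y; rewrite /F [1 + _]addrC [- 2^-1 * _]mulNr.
apply: is_derive_eq h4 _; rewrite /= mul0r add0r mul0r add0r [ka * t + 1]addrC.
have -> : - (3 / 2 * ln (1 + ka * t)) = - 2^-1 * ln (1 + ka * t) - ln (1 + ka * t).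
  by field.
rewrite expRB lnK ?posrE//.
by field; rewrite !gt_eqF.
Qed.

(** The function [(1 + ka |t|)^(- 3 / 2)]. *)
Definition heavy_tail ka t : R := expR (- (3 / 2 * ln (1 + ka * `|t|))).

Lemma continuous_heavy_tail ka : 0 < ka -> continuous (heavy_tail ka).
Proof.
move=> ka0 t.
have u0 : 0 < 1 + ka * `|t| by rewrite ltr_pwDl// mulr_ge0// ltW.
apply: (@continuous_comp _ _ _ (fun t : R => - (3 / 2 * ln (1 + ka * `|t|))) (@expR R));
  last exact: continuous_expR.
apply: (@cvgN _ R^o); apply: cvgM; first exact: cvg_cst.
apply: (@continuous_comp _ _ _ (fun t : R => 1 + ka * `|t|) (@ln R));
  last exact: continuous_ln.
apply: (@cvgD _ R^o); first exact: cvg_cst.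
by apply: cvgM; [exact: cvg_cst|exact: norm_continuous].
Qed.

Lemma integral_heavy_tail ka : 0 < ka ->
  (\int[mu]_t (heavy_tail ka t)%:E = (4 / ka)%:E)%E.
Proof.
move=> ka0; rewrite ge0_symfun_integralT; first last.
- by move=> t; rewrite /heavy_tail /= normrN.
- exact: continuous_heavy_tail.
- by move=> t; exact: expR_ge0.
rewrite -set_itvcy (@ge0_continuous_FTC2y _ (heavy_tail ka) (F ka) 0 0).
- rewrite /F mulr0 addr0 ln1 mulr0 oppr0 expR0 mulr1 sub0e -EFinN opprK -EFinM.
  by congr EFin; ring.
- by move=> t _; exact: expR_ge0.
- by apply: continuous_subspaceT; exact: continuous_heavy_tail.
- apply/cvgr0Pnorm_le => e e0.
  near=> t.
  have t0 : 0 <= t by near: t; exact: nbhs_pinfty_ge.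
  have te : (2 / (ka * e)) ^+ 2 / ka <= t.
    by near: t; apply: nbhs_pinfty_ge; exact: num_real.
  have u0 : 0 <= ka * t by rewrite mulr_ge0// ltW.
  rewrite /F -invsqrt_expR; last by lra.
  rewrite mulNr normrN normrM ger0_norm ?divr_ge0 ?(ltW ka0)//.
  rewrite ger0_norm ?invr_ge0// ler_pdivrMr ?sqrtr_gt0; last by lra.
  have -> : 2 / ka = e * (2 / (ka * e)) by field; rewrite !gt_eqF.
  rewrite ler_pM2l//.
  have p0 : 0 <= 2 / (ka * e) by rewrite divr_ge0// mulr_ge0// ltW.
  rewrite -(ger0_norm p0) -sqrtr_sqr ler_wsqrtr//.
  by move: te; rewrite ler_pdivrMr//; lra.
- by move=> t /ltW t0; have [] := dF ka0 t0.
- apply: cvg_at_right_filter; apply: differentiable_continuous.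
  by apply/derivable1_diffP; have [] := dF ka0 (lexx 0).
- move=> t; rewrite in_itv/= andbT => t0.
  have h := dF ka0 (ltW t0).
  by rewrite derive1E (@derive_val _ _ _ _ _ _ _ h) /heavy_tail gtr0_norm.
Unshelve. all: by end_near. Qed.

(** The Gaussian part contributes [sqrt (2 pi / D)] with [D = A1 + B1]. In the
    tail part [e^(- 3 B1 / (4 A1)) <= sqrt (A1 / D)], because
    [D / A1 = 1 + B1 / A1 <= e^(B1 / A1)]. The sum is at most
    [(pi / 2 + 1 + 17 / 5 * sqrt 3) / sqrt D], and [2 <= pi] is enough to
    compare it with [4 pi / sqrt D]. *)
Lemma integral_dominating_function (A1 B1 : R) (ka := Num.sqrt (4 * A1 / 3))
    (G := fun t : R => expR (- ((A1 + B1) / 2 * t ^+ 2)) +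
      17 / 10 * expR (- (3 * B1 / (4 * A1))) * heavy_tail ka t) :
  0 < A1 -> 0 <= B1 ->
  mu.-integrable [set: R] (EFin \o G) /\
  \int[mu]_t G t <= 4 * pi / Num.sqrt (A1 + B1).
Proof.
move=> A0 B0.
have D0 : 0 < A1 + B1 by lra.
have ka0 : 0 < ka by rewrite sqrtr_gt0; lra.
have mt : measurable_fun [set: R] (heavy_tail ka).
  by apply: continuous_measurable_fun; exact: continuous_heavy_tail.
have it : mu.-integrable [set: R] (EFin \o heavy_tail ka).
  apply/integrableP; split; first exact/measurable_EFinP.
  under eq_integral do rewrite /= ger0_norm ?expR_ge0//.
  by rewrite integral_heavy_tail// ltry.
have D20 : 0 < (A1 + B1) / 2 by lra.
split.
  rewrite (_ : _ \o _ = (EFin \o (fun t => expR (- ((A1 + B1) / 2 * t ^+ 2)))) \+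
    (EFin \o (fun t => 17 / 10 * expR (- (3 * B1 / (4 * A1))) * heavy_tail ka t)))//.
  by apply: integrableD => //; [exact: integrable_gaussian0|exact: integrable_scale].
rewrite RintegralD//; [|exact: integrable_gaussian0|exact: integrable_scale].
have -> : \int[mu]_t (17 / 10 * expR (- (3 * B1 / (4 * A1))) * heavy_tail ka t) =
    17 / 10 * expR (- (3 * B1 / (4 * A1))) * (4 / ka).
  by rewrite RintegralZl//; congr *%R; rewrite /Rintegral integral_heavy_tail.
have -> : \int[mu]_t expR (- ((A1 + B1) / 2 * t ^+ 2)) =
    Num.sqrt (pi / ((A1 + B1) / 2)).
  rewrite -(Rintegral_gaussian 0 D20).
  by apply: eq_Rintegral => t _; rewrite subr0.
have pi2 := pi_ge2 R.
set sD := Num.sqrt (A1 + B1).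
have sD0 : 0 < sD by rewrite sqrtr_gt0.
have h1 : Num.sqrt (pi / ((A1 + B1) / 2)) <= (pi / 2 + 1) / sD.
  have q0 : 0 <= (pi / 2 + 1) / sD by rewrite divr_ge0 ?ltW//; lra.
  rewrite -(ger0_norm q0) -sqrtr_sqr ler_wsqrtr// exprMn exprVn sqr_sqrtr ?(ltW D0)//.
  rewrite invf_div mulrA ler_wpM2r ?invr_ge0 ?(ltW D0)//.
  by have := sqr_ge0 (pi / 2 - 1 : R); lra.
have s3 : Num.sqrt (3 : R) <= 7 / 4.
  have q0 : 0 <= 7 / 4 :> R by lra.
  by rewrite -(ger0_norm q0) -sqrtr_sqr ler_wsqrtr// expr2; lra.
have h2 : expR (- (3 * B1 / (4 * A1))) * (4 / ka) <= 2 * Num.sqrt 3 / sD.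
  have s30 : 0 < Num.sqrt (3 : R) by rewrite sqrtr_gt0.
  have sA0 : 0 < Num.sqrt A1 by rewrite sqrtr_gt0.
  have kaE : ka = 2 * Num.sqrt A1 / Num.sqrt 3.
    have q0 : 0 <= 2 * Num.sqrt A1 / Num.sqrt 3 by rewrite divr_ge0// mulr_ge0.
    rewrite -[RHS](ger0_norm q0) -sqrtr_sqr /ka; congr Num.sqrt.
    rewrite exprMn exprVn exprMn !sqr_sqrtr ?(ltW A0)//.
    by rewrite expr2 -natrM.
  have -> : 4 / ka = 2 * Num.sqrt 3 / Num.sqrt A1.
    by rewrite kaE; field; rewrite !gt_eqF.
  have -> : forall u : R, u * (2 * Num.sqrt 3 / Num.sqrt A1) =
    2 * Num.sqrt 3 * (u / Num.sqrt A1) by move=> u; ring.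
  rewrite ler_pM2l ?mulr_gt0// ler_pdivrMr// [leRHS]mulrC ler_pdivlMr//.
  rewrite -[leLHS]ger0_norm ?mulr_ge0 ?expR_ge0 ?(ltW sD0)//.
  rewrite -sqrtr_sqr ler_wsqrtr//.
  rewrite exprMn sqr_sqrtr ?(ltW D0)// -expRM_natl mulrN expRN.
  rewrite [leLHS]mulrC ler_pdivrMr ?expR_gt0//.
  have h := expR_ge1Dx (2 * (3 * B1 / (4 * A1))).
  have : A1 * (1 + 2 * (3 * B1 / (4 * A1))) <= A1 * expR (2 * (3 * B1 / (4 * A1))).
    by rewrite ler_wpM2l// ltW.
  have -> : A1 * (1 + 2 * (3 * B1 / (4 * A1))) = A1 + 3 / 2 * B1.
    by field; rewrite gt_eqF.
  by lra.
apply: (@le_trans _ _ ((pi / 2 + 1) / sD + 17 / 10 * (2 * Num.sqrt 3 / sD))).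
  rewrite lerD// -mulrA ler_pM2l//.
have -> : (pi / 2 + 1) / sD + 17 / 10 * (2 * Num.sqrt 3 / sD) =
  (pi / 2 + 1 + 17 / 10 * 2 * Num.sqrt 3) / sD by ring.
by rewrite ler_wpM2r ?invr_ge0 ?(ltW sD0)//; lra.
Qed.

End dominating_function.

Section density_upper_bound.
Context d (T : measurableType d) (R : realType) (P : probability T R).
Notation mu := (@lebesgue_measure R).

Section gaussian_smoothing.
Variables (W : T -> R) (mW : measurable_fun [set: T] W).
Variables (G : R -> R) (x0 : R).
Hypothesis iG : mu.-integrable [set: R] (EFin \o G).
Hypothesis WG : forall t, \int[P]_w cos ((W w - x0) * t) <= G t.
Hypothesis G0 : forall t, 0 <= G t.

(** A regularized Fourier inversion. The Gaussian kernel is the transform of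
    [e^(- al t^2)], so by Fubini its expectation at [W - x0] is an integral of
    [E cos ((W - x0) t) e^(- al t^2)], in which the last factor is at most
    [1]. *)
Lemma gaussian_smoothing_le (al : R) : 0 < al ->
  Num.sqrt (pi / al) * \int[P]_w expR (- ((4 * al)^-1 * (W w - x0) ^+ 2)) <=
  \int[mu]_t G t.
Proof.
move=> al0.
have mWx : measurable_fun [set: T] (fun w => W w - x0) by exact: measurable_funB.
have mcos := @measurable_cos R.
have mgau : measurable_fun [set: R] (fun t : R => expR (- (al * t ^+ 2))).
  by have /integrableP[/measurable_EFinP] := integrable_gaussian0 al0.
have mga : measurable_fun [set: T] (fun w => expR (- ((4 * al)^-1 * (W w - x0) ^+ 2))).
  apply: measurableT_comp; first exact: measurable_expR.
  apply: measurableT_comp; first exact: oppr_measurable.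
  by apply: measurable_funM => //; exact: measurable_funX.
rewrite -RintegralZl//; last first.
  apply: (@bounded_integrable _ _ _ P _ 1) => // w.
  rewrite ger0_norm ?expR_ge0// -expR0 ler_expR oppr_le0.
  by rewrite mulr_ge0 ?sqr_ge0 ?invr_ge0 ?mulr_ge0// ltW.
pose k w t := cos ((W w - x0) * t + 0) * expR (- (al * t ^+ 2)).
rewrite [leLHS](_ : _ = \int[P]_w \int[mu]_t k w t); last first.
  apply: eq_Rintegral => w _; rewrite /k gaussian_fourier// cos0 mul1r.
  by rewrite [_ ^+ 2 / _]mulrC.
have mk : measurable_fun [set: T * R] (fun z : T * R => k z.1 z.2).
  apply: measurable_funM; last by apply: (measurableT_comp mgau); exact: measurable_snd.
  apply: (measurableT_comp mcos); apply: measurable_funD => //.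
  apply: measurable_funM; last exact: measurable_snd.
  by apply: (measurableT_comp mWx); exact: measurable_fst.
have kle w t : `|k w t| <= expR (- (al * t ^+ 2)).
  by rewrite normrM [X in _ * X]ger0_norm ?expR_ge0// ler_piMl ?expR_ge0// cos_max.
have ik2 w : mu.-integrable [set: R] (EFin \o k w) by exact: integrable_cos_gaussian.
have ik1 t : P.-integrable [set: T] (EFin \o (k ^~ t)).
  apply: (@bounded_integrable _ _ _ P _ (expR (- (al * t ^+ 2)))) => //.
  exact: (measurable_comp measurableT _ mk (measurable_pair2 t)).
have hle (w : T) : \int[mu]_t expR (- (al * t ^+ 2)) <= Num.sqrt (pi / al).
  rewrite -(Rintegral_gaussian 0 al0).
  by under [leRHS]eq_Rintegral do rewrite subr0.
have iP : P.-integrable [set: T] (EFin \o (fun=> Num.sqrt (pi / al))).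
  exact: finite_measure_integrable_cst.
have [mK ->] := @Rintegral_fubini _ _ _ _ _ P mu k _ _ mk ik2 ik1 kle
  (fun=> integrable_gaussian0 al0) hle iP.
have iK : mu.-integrable [set: R] (EFin \o (fun t => \int[P]_w k w t)).
  apply: (le_integrable measurableT _ _ (integrable_gaussian0 al0)).
    exact/measurable_EFinP.
  move=> t _ /=; rewrite lee_fin [leRHS]ger0_norm ?expR_ge0//.
  rewrite (le_trans (le_normr_Rintegral measurableT (ik1 t)))//.
  have -> : expR (- (al * t ^+ 2)) = \int[P]_w expR (- (al * t ^+ 2)).
    rewrite Rintegral_cst// [fine _](_ : _ = 1) ?mulr1//.
    by have := congr1 fine (@probability_setT _ _ _ P).
  apply: le_Rintegral => //; first exact: integrable_norm.
  exact: finite_measure_integrable_cst.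
apply: le_Rintegral => // t _.
rewrite /k RintegralZr//; last first.
  apply: (@bounded_integrable _ _ _ P _ 1); last by move=> w; exact: cos_max.
  apply: (measurableT_comp mcos); apply: measurable_funD => //.
  by apply: measurable_funM.
under eq_Rintegral do rewrite addr0.
apply: (@le_trans _ _ (G t * expR (- (al * t ^+ 2)))).
  by rewrite ler_wpM2r ?expR_ge0.
rewrite ler_piMr// -[leRHS]expR0 ler_expR oppr_le0.
by rewrite mulr_ge0 ?sqr_ge0 ?(ltW al0).
Qed.

End gaussian_smoothing.

(** Outside the interval of radius [de] the kernel is at most
    [e^(- ga de^2 / 2)] times the wider kernel with [ga / 2]. Hence
    [c (e^(- ga u^2) - e^(- ga de^2 / 2) e^(- ga u^2 / 2))] is a minorant of
    the integrand on the whole line, and its integral is explicit. *)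
Lemma density_gaussian_smoothing_ge (p : R -> R) (x0 c de ga : R) :
  (forall x, 0 <= p x) -> 0 <= c -> 0 < de -> 0 < ga ->
  mu.-integrable [set: R] (EFin \o (fun x => p x * expR (- (ga * (x - x0) ^+ 2)))) ->
  (forall x, `|x - x0| < de -> c <= p x) ->
  c * Num.sqrt (pi / ga) * (1 - Num.sqrt 2 * expR (- (ga / 2 * de ^+ 2))) <=
  \int[mu]_x (p x * expR (- (ga * (x - x0) ^+ 2))).
Proof.
move=> p0 c0 de0 ga0 ip cp.
have ga20 : 0 < ga / 2 by rewrite divr_gt0.
pose e := expR (- (ga / 2 * de ^+ 2)).
have i1 := integrable_gaussian x0 ga0.
have i2 := integrable_gaussian x0 ga20.
have -> : c * Num.sqrt (pi / ga) * (1 - Num.sqrt 2 * e) =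
    \int[mu]_x (c * expR (- (ga * (x - x0) ^+ 2)) -
                c * e * expR (- (ga / 2 * (x - x0) ^+ 2))).
  rewrite RintegralB//; [|exact: integrable_scale|exact: integrable_scale].
  rewrite !RintegralZl// !Rintegral_gaussian//.
  have -> : pi / (ga / 2) = 2 * (pi / ga) by field; rewrite gt_eqF.
  by rewrite (@sqrtrM _ 2)//; ring.
apply: le_Rintegral => //.
- have h1 := integrable_scale c i1; have h2 := integrable_scale (c * e) i2.
  exact: (integrableB measurableT h1 h2).
move=> x _; set u := x - x0.
have [ud|du] := ltP `|u| de.
  apply: (@le_trans _ _ (c * expR (- (ga * u ^+ 2)))).
    by rewrite gerBl !mulr_ge0 ?expR_ge0.
  by rewrite ler_wpM2r ?expR_ge0// cp.
apply: (@le_trans _ _ 0); last by rewrite mulr_ge0 ?expR_ge0.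
rewrite subr_le0 -mulrA ler_wpM2l// -expRD ler_expR.
have : de ^+ 2 <= u ^+ 2.
  by rewrite -[leRHS]real_normK ?num_real// ler_pXn2r ?nnegrE// ltW.
move=> h; have h2 : ga / 2 * de ^+ 2 <= ga / 2 * u ^+ 2 by rewrite ler_pM2l.
by lra.
Qed.

End density_upper_bound.

Section quad_form_upper_bound.
Context d (T : measurableType d) (R : realType) (P : probability T R).
Context (n : nat) (Z : 'I_n -> {RV P >-> R}).
Hypothesis Znormal : forall k, standard_normal (Z k).
Hypothesis Zind : mutually_independent Z.
Variables lam a : 'I_n -> R.
Notation mu := (@lebesgue_measure R).
Let W := quad_form_rv lam a Z.
Let A1 := \sum_k lam k ^+ 2.
Let B1 := \sum_k lam k ^+ 2 * a k ^+ 2.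
Hypothesis A1_gt0 : 0 < A1.
Hypothesis lamA : forall k, lam k ^+ 2 <= A1 / 3.

(** [E cos (t W - t x0)] is the scalar product of [(E cos (t W), E sin (t W))]
    with a unit vector. *)
Lemma trig_shift_le (x0 t r : R) : 0 <= r ->
  (\int[P]_w cos (t * W w)) ^+ 2 + (\int[P]_w sin (t * W w)) ^+ 2 <= r ^+ 2 ->
  \int[P]_w cos ((W w - x0) * t) <= r.
Proof.
move=> r0 CSr; set C := \int[P]_w cos (t * W w) in CSr *.
set S := \int[P]_w sin (t * W w) in CSr *.
have mtW : measurable_fun [set: T] (fun w => t * W w).
  by apply: measurable_funM => //; exact: measurable_quad_form.
have iC : P.-integrable [set: T] (EFin \o (fun w => cos (t * W w))).
  apply: (@bounded_integrable _ _ _ P _ 1); last by move=> w; exact: cos_max.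
  exact: (measurableT_comp (@measurable_cos R)).
have iS : P.-integrable [set: T] (EFin \o (fun w => sin (t * W w))).
  apply: (@bounded_integrable _ _ _ P _ 1); last by move=> w; exact: sin_max.
  exact: (measurableT_comp (@measurable_sin R)).
have -> : \int[P]_w cos ((W w - x0) * t) = cos (t * x0) * C + sin (t * x0) * S.
  rewrite -RintegralZl// -[X in _ + X]RintegralZl// -RintegralD//; first last.
  - exact: integrable_scale.
  - exact: integrable_scale.
  apply: eq_Rintegral => w _.
  have -> : (W w - x0) * t = t * W w - t * x0 by ring.
  by rewrite cosB; ring.
have cs := cos2Dsin2 (t * x0).
have h : (cos (t * x0) * C + sin (t * x0) * S) ^+ 2 <= r ^+ 2.
  apply: le_trans CSr.
  have -> : C ^+ 2 + S ^+ 2 = (cos (t * x0) ^+ 2 + sin (t * x0) ^+ 2) * (C ^+ 2 + S ^+ 2).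
    by rewrite cs mul1r.
  rewrite -subr_ge0.
  have -> : (cos (t * x0) ^+ 2 + sin (t * x0) ^+ 2) * (C ^+ 2 + S ^+ 2) -
    (cos (t * x0) * C + sin (t * x0) * S) ^+ 2 =
    (cos (t * x0) * S - sin (t * x0) * C) ^+ 2 by ring.
  exact: sqr_ge0.
rewrite (le_trans (ler_norm _))// -(ger0_norm r0).
by rewrite -!sqrtr_sqr ler_wsqrtr.
Qed.

(** The two regimes are separated at [v = 4 A1 t^2 / 3 = 1]. For large [v], the
    bound [(1 + v)^(- 3 / 4)] is replaced by a multiple of [heavy_tail], which
    has an elementary primitive: [(1 + ka |t|)^2 <= 2 (1 + v)], and
    [17 / 10] is an upper bound for [2^(3 / 4)]. *)
Lemma charfun_quad_form_le (x0 t : R) :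
  \int[P]_w cos ((W w - x0) * t) <=
  expR (- ((A1 + B1) / 2 * t ^+ 2)) +
    17 / 10 * expR (- (3 * B1 / (4 * A1))) * heavy_tail (Num.sqrt (4 * A1 / 3)) t.
Proof.
have B0 : 0 <= B1 by apply: sumr_ge0 => k _; rewrite mulr_ge0 ?sqr_ge0.
set ka := Num.sqrt _; set v := 4 * A1 / 3 * t ^+ 2.
have q0 : 0 <= 4 * A1 / 3 by rewrite divr_ge0// mulr_ge0// ltW.
have vE : (ka * `|t|) ^+ 2 = v by rewrite exprMn sqr_sqrtr// real_normK ?num_real.
have E1 : 0 <= expR (- ((A1 + B1) / 2 * t ^+ 2)) by exact: expR_ge0.
have E2 : 0 <= 17 / 10 * expR (- (3 * B1 / (4 * A1))) * heavy_tail ka t.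
  by rewrite mulr_ge0 ?expR_ge0// mulr_ge0 ?expR_ge0// divr_ge0.
apply: trig_shift_le; first by rewrite addr_ge0.
have [v1|v1] := leP v 1.
  apply: (@le_trans _ _ (expR (- ((A1 + B1) / 2 * t ^+ 2)) ^+ 2)); last first.
    by rewrite ler_pXn2r ?nnegrE ?addr_ge0// lerDl.
  rewrite -expRM_natl mulrN.
  have -> : 2 * ((A1 + B1) / 2 * t ^+ 2) = t ^+ 2 * (A1 + B1) by field.
  apply: charfun_modulus_small => // k; rewrite exprMn.
  apply: le_trans v1; rewrite /v [t ^+ 2 * _]mulrC mulrA ler_wpM2r ?sqr_ge0//.
  by have := lamA k; lra.
apply: (@le_trans _ _ ((17 / 10 * expR (- (3 * B1 / (4 * A1))) *
  heavy_tail ka t) ^+ 2)); last first.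
  by rewrite ler_pXn2r ?nnegrE ?addr_ge0// lerDr.
have L : (\int[P]_w cos (t * W w)) ^+ 2 + (\int[P]_w sin (t * W w)) ^+ 2 <=
    expR (- (3 / 2 * ln (1 + v) + 3 * B1 / (2 * A1))).
  by apply: charfun_modulus_large => //; exact: ltW.
apply: (le_trans L).
have u0 : 0 <= ka * `|t| by rewrite mulr_ge0 ?sqrtr_ge0.
have u10 : 0 < 1 + ka * `|t| by lra.
have v10 : 0 < 1 + v by lra.
have lnle : 2 * ln (1 + ka * `|t|) <= ln 2 + ln (1 + v).
  rewrite -lnM ?posrE// mulr_natl -lnXn// ler_ln ?posrE ?mulr_gt0 ?exprn_gt0//.
  by rewrite -vE; have := sqr_ge0 (ka * `|t| - 1); lra.
have e2 : expR (3 / 4 * ln 2) <= 17 / 10 :> R.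
  have h : expR (3 / 4 * ln 2) ^+ 4 = 8 :> R.
    rewrite -expRM_natl mulrA.
    have -> : 4 * (3 / 4) = 3 :> R by field.
    by rewrite expRM_natl lnK ?posrE// -natrX.
  rewrite -(@ler_pXn2r _ 4) ?nnegrE ?expR_ge0 ?divr_ge0// h.
  by rewrite !exprS expr0; lra.
have e20 := expR_ge0 (3 / 4 * ln 2 : R).
apply: (@le_trans _ _ ((expR (3 / 4 * ln 2) * expR (- (3 * B1 / (4 * A1))) *
  heavy_tail ka t) ^+ 2)); last first.
  rewrite ler_pXn2r ?nnegrE ?mulr_ge0 ?expR_ge0//.
  by rewrite ler_wpM2r ?expR_ge0// ler_wpM2r ?expR_ge0.
rewrite /heavy_tail -!expRD -expRM_natl ler_expR.
have -> : 3 * B1 / (2 * A1) = 2 * (3 * B1 / (4 * A1)) by field; rewrite gt_eqF.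
by lra.
Qed.

(** If [p x0] exceeded the bound [M0], continuity would give [c > M0] with
    [p >= c] near [x0]. Smoothing at scale [ga] then yields
    [c (1 - sqrt 2 e^(- ga de^2 / 2)) <= M0] for all [ga > 0], which fails for
    large [ga]. *)
Lemma quad_form_density_le (p : R -> R) : is_density P W p ->
  {within `]0, +oo[, continuous p} ->
  forall x : R, 0 < x -> p x <= 2 / Num.sqrt (A1 + B1).
Proof.
move=> pW pc x0 x00.
have B0 : 0 <= B1 by apply: sumr_ge0 => k _; rewrite mulr_ge0 ?sqr_ge0.
have D0 : 0 < A1 + B1 by rewrite ltr_pwDl.
have [iG hG] := integral_dominating_function A1_gt0 B0.
have mW : measurable_fun [set: T] W by exact: measurable_quad_form.
set M0 := 2 / _; rewrite leNgt; apply/negP => Mp.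
have M00 : 0 < M0 by rewrite divr_gt0// sqrtr_gt0.
pose c := (M0 + p x0) / 2.
have Mc : M0 < c by rewrite /c; lra.
have cp : c < p x0 by rewrite /c; lra.
have px0 : {for x0, continuous p}.
  move: pc; rewrite continuous_open_subspace; last exact: interval_open.
  by move=> /(_ x0); apply; rewrite inE/= in_itv/= x00.
have [de de0 cde] : exists2 de : R, 0 < de & forall x, `|x - x0| < de -> c <= p x.
  have /cvgrPdist_lt /(_ (p x0 - c)) := px0.
  rewrite subr_gt0 => /(_ cp) /nbhs_ballP[de/= de0 h]; exists de => // x xde.
  have : `|p x0 - p x| < p x0 - c by apply: h; rewrite /ball/= distrC.
  by rewrite ltr_norml => /andP[_]; lra.
have [mp p0 PW] := pW.
have key (ga : R) : 0 < ga ->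
    c * (1 - Num.sqrt 2 * expR (- (ga / 2 * de ^+ 2))) <= M0.
  move=> ga0.
  have mg : measurable_fun [set: R] (fun x => expR (- (ga * (x - x0) ^+ 2))).
    by apply: continuous_measurable_fun; exact: continuous_gaussian.
  have g1 x : `|expR (- (ga * (x - x0) ^+ 2))| <= 1.
    rewrite ger0_norm ?expR_ge0// -expR0 ler_expR oppr_le0.
    by rewrite mulr_ge0 ?sqr_ge0 ?(ltW ga0).
  have [ip ep] := bounded_integral_density mW pW mg g1.
  have h1 := density_gaussian_smoothing_ge p0 (ltW (lt_trans M00 Mc)) de0 ga0 ip cde.
  have al0 : 0 < (4 * ga)^-1 by rewrite invr_gt0 mulr_gt0.
  have h2 := gaussian_smoothing_le mW iG (charfun_quad_form_le x0) _ al0.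
  have galE : (4 * (4 * ga)^-1)^-1 = ga by field; rewrite gt_eqF.
  rewrite galE ep in h2.
  have {}h2 := le_trans (h2 _) hG.
  have G0 t : 0 <= expR (- ((A1 + B1) / 2 * t ^+ 2)) +
      17 / 10 * expR (- (3 * B1 / (4 * A1))) * heavy_tail (Num.sqrt (4 * A1 / 3)) t.
    by rewrite addr_ge0 ?expR_ge0// mulr_ge0 ?expR_ge0// mulr_ge0 ?expR_ge0// divr_ge0.
  move: (h2 G0) => {}h2.
  have pi0 : 0 < pi :> R by exact: pi_gt0.
  have sq : Num.sqrt (pi / (4 * ga)^-1) * Num.sqrt (pi / ga) = 2 * pi :> R.
    rewrite -sqrtrM ?divr_ge0 ?(ltW pi0) ?(ltW al0)//.
    have -> : pi / (4 * ga)^-1 * (pi / ga) = (2 * pi) ^+ 2.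
      by field; rewrite !gt_eqF.
    by rewrite sqrtr_sqr ger0_norm// mulr_ge0// ltW.
  set E := 1 - _ in h1 *.
  have h3 : Num.sqrt (pi / (4 * ga)^-1) * (c * Num.sqrt (pi / ga) * E) <=
      4 * pi / Num.sqrt (A1 + B1).
    by apply: le_trans h2; rewrite ler_wpM2l// sqrtr_ge0.
  rewrite -(@ler_pM2l _ (2 * pi)) ?mulr_gt0//.
  have -> : 2 * pi * M0 = 4 * pi / Num.sqrt (A1 + B1) by rewrite /M0; ring.
  apply: le_trans h3; rewrite -sq le_eqVlt; apply/orP; left; apply/eqP.
  by ring.
(* [y] is the value of [ga de^2 / 2]; since [e^y >= 1 + y] it is large enough *)
pose y := 2 * c / (c - M0).
have cM0 : 0 < c - M0 by rewrite subr_gt0.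
have c0 : 0 < c by lra.
have y0 : 0 < y by rewrite divr_gt0// mulr_gt0.
have ga0 : 0 < 2 * y / de ^+ 2 by rewrite divr_gt0 ?exprn_gt0// mulr_gt0.
have := key _ ga0.
have -> : 2 * y / de ^+ 2 / 2 * de ^+ 2 = y by field; rewrite gt_eqF.
have e1 := expR_ge1Dx y.
have en : expR (- y) * expR y = 1 by rewrite mulrC expRxMexpNx_1.
have en0 := expR_gt0 (- y).
have s2 : Num.sqrt (2 : R) <= 2.
  have q0 : 0 <= 2 :> R by [].
  by rewrite -[leRHS](ger0_norm q0) -sqrtr_sqr ler_wsqrtr// expr2; lra.
move=> h.
have h4 : c - M0 <= 2 * c * expR (- y).
  have : c * (Num.sqrt 2 * expR (- y)) <= c * (2 * expR (- y)).
    by rewrite ler_pM2l// ler_pM2r.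
  by lra.
have h5 : (c - M0) * (1 + y) <= 2 * c.
  apply: (@le_trans _ _ ((c - M0) * expR y)); first by rewrite ler_pM2l.
  apply: (@le_trans _ _ (2 * c * expR (- y) * expR y)).
    by rewrite ler_pM2r// expR_gt0.
  by rewrite -mulrA en mulr1.
have h6 : (c - M0) * y = 2 * c by rewrite /y mulrC divfK// gt_eqF.
by move: h5; rewrite mulrDr mulr1 h6 gerDr leNgt cM0.
Qed.

End quad_form_upper_bound.

(** * Lower bound for the density *)

Section laplace.
Context d (T : measurableType d) (R : realType) (P : probability T R).
Context (n : nat) (Z : 'I_n -> {RV P >-> R}).
Hypothesis Znormal : forall k, standard_normal (Z k).
Hypothesis Zind : mutually_independent Z.
Variables lam a : 'I_n -> R.
Notation mu := (@lebesgue_measure R).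
Let W := quad_form_rv lam a Z.
Let m := \sum_k lam k * (1 + a k ^+ 2).
Let D := \sum_k lam k ^+ 2 + \sum_k lam k ^+ 2 * a k ^+ 2.

(** Completing the square in the Gaussian integral. *)
Lemma normal_square_laplace (x b : R) : -1 < x ->
  (\int[mu]_y (normal_pdf 0 1 y *
     expR (- (x / 2 * ((y - b) ^+ 2 - (1 + b ^+ 2)))))%:E =
  ((Num.sqrt (1 + x))^-1 * expR (x / 2 + x ^+ 2 * b ^+ 2 / (2 * (1 + x))))%:E)%E.
Proof.
move=> x1; have u0 : 0 < 1 + x by lra.
have al0 : 0 < (1 + x) / 2 by rewrite divr_gt0.
pose K := expR (x / 2 + x ^+ 2 * b ^+ 2 / (2 * (1 + x))).
transitivity (\int[mu]_y (((Num.sqrt (2 * pi))^-1 * K)%:E *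
    (expR (- ((1 + x) / 2 * (y - x * b / (1 + x)) ^+ 2)))%:E))%E.
  apply: eq_integral => y _; rewrite -EFinM; congr EFin.
  rewrite standard_normal_pdfE -!mulrA; congr *%R; rewrite /K -!expRD; congr expR.
  by field; rewrite gt_eqF.
rewrite ge0_integralZl//; last 2 first.
- by apply/measurable_EFinP; apply: continuous_measurable_fun; exact: continuous_gaussian.
- by rewrite lee_fin mulr_ge0 ?expR_ge0// invr_ge0 sqrtr_ge0.
rewrite integral_gaussian// -EFinM; congr EFin.
rewrite mulrAC; congr *%R.
have pi0 : 0 < pi :> R by exact: pi_gt0.
have -> : pi / ((1 + x) / 2) = 2 * pi / (1 + x) by field; rewrite gt_eqF.
rewrite [Num.sqrt (2 * pi / _)]sqrtrM ?mulr_ge0 ?(ltW pi0)//.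
rewrite sqrtrV ?(ltW u0)// mulKf// gt_eqF//.
by rewrite sqrtr_gt0 mulr_gt0.
Qed.

(** The constant [m] is the mean of [W]: centering cancels the linear term in
    [s]. With [x = - 2 s lam_k], each factor of the product is at most
    [e^(x^2 (1 + a_k^2) / (2 (1 + x)))] because [ln (1 + x) >= x / (1 + x)]. *)
Lemma laplace_quad_form (s eta : R) : eta < 1 ->
  (forall k, `|2 * s * lam k| <= eta) ->
  (\int[P]_w (expR (s * (W w - m)))%:E <= (expR (2 * s ^+ 2 * D / (1 - eta)))%:E)%E.
Proof.
move=> eta1 seta.
pose x k := - (2 * s * lam k).
have xeta k : `|x k| <= eta by rewrite normrN.
have x1 k : 1 - eta <= 1 + x k.
  by have := xeta k; rewrite ler_norml => /andP[]; lra.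
have xN1 k : -1 < x k by have := x1 k; lra.
pose f k (y : R) := expR (- (x k / 2 * ((y - a k) ^+ 2 - (1 + a k ^+ 2)))).
pose e k := (Num.sqrt (1 + x k))^-1 *
  expR (x k / 2 + x k ^+ 2 * a k ^+ 2 / (2 * (1 + x k))).
have mf k : measurable_fun [set: R] (f k).
  apply: measurableT_comp; first exact: measurable_expR.
  apply: measurableT_comp; first exact: oppr_measurable.
  apply: measurable_funM => //; apply: measurable_funB => //.
  by apply: measurable_funX; exact: measurable_funB.
have f0 k y : 0 <= f k y by exact: expR_ge0.
have fe k : (\int[P]_w (f k (Z k w))%:E = (e k)%:E)%E.
  have mZ : measurable_fun [set: T] (Z k) by [].
  rewrite (integral_density mZ (standard_normal_density (Znormal k)) (mf k) (f0 k)).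
  exact: normal_square_laplace.
have -> : (fun w => (expR (s * (W w - m)))%:E) =
    (fun w => (\prod_(k < n) f k (Z k w))%:E).
  apply/funext => w; congr EFin; rewrite -expR_sum; congr expR.
  rewrite /W /quad_form_rv /m -sumrB mulr_sumr; apply: eq_bigr => k _.
  by rewrite /x; field.
rewrite (ge0_integral_prod_indep Zind mf f0 fe) lee_fin.
have -> : 2 * s ^+ 2 * D / (1 - eta) =
    \sum_(k < n) 2 * s ^+ 2 * (lam k ^+ 2 * (1 + a k ^+ 2)) / (1 - eta).
  rewrite -mulr_suml -mulr_sumr; congr (_ * _ / _).
  by rewrite /D -big_split/=; apply: eq_bigr => k _; ring.
rewrite expR_sum; apply: ler_prod => k _.
rewrite mulr_ge0 ?expR_ge0 ?invr_ge0 ?sqrtr_ge0//=.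
rewrite /e invsqrt_expR// -expRD ler_expR.
have u0 : 0 < 1 + x k by have := xN1 k; lra.
have h1 := ln1D_ge (xN1 k).
apply: (@le_trans _ _ (x k ^+ 2 * (1 + a k ^+ 2) / (2 * (1 + x k)))).
  have -> : x k ^+ 2 * (1 + a k ^+ 2) / (2 * (1 + x k)) =
    - (2^-1 * (x k / (1 + x k))) + (x k / 2 + x k ^+ 2 * a k ^+ 2 / (2 * (1 + x k))).
    by field; rewrite gt_eqF.
  by rewrite lerD2r; lra.
have -> : 2 * s ^+ 2 * (lam k ^+ 2 * (1 + a k ^+ 2)) = x k ^+ 2 * (1 + a k ^+ 2) / 2.
  by rewrite /x; field.
have -> : x k ^+ 2 * (1 + a k ^+ 2) / (2 * (1 + x k)) =
  x k ^+ 2 * (1 + a k ^+ 2) / 2 / (1 + x k) by field; rewrite gt_eqF.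
have sq0 : 0 <= x k ^+ 2 * (1 + a k ^+ 2) / 2.
  by rewrite divr_ge0// mulr_ge0 ?sqr_ge0// addr_ge0 ?sqr_ge0.
rewrite ler_wpM2l//.
by rewrite lef_pV2 ?posrE// subr_gt0.
Qed.

End laplace.

Section second_moment.
Context {R : realType}.

(** Equivalently [v <= sinh v] for [v = u / 2 >= 0], which holds because
    [cosh >= 1]. *)
Lemma sqr_le_exp_sum (u : R) : u ^+ 2 + 2 <= expR u + expR (- u).
Proof.
wlog u0 : u / 0 <= u => [hw|].
  have [/hw//|/ltW u0] := leP 0 u.
  have := hw (- u); rewrite sqrrN opprK [expR (- u) + _]addrC; apply.
  by rewrite oppr_ge0.
have key (v : R) : 0 <= v -> 2 * v <= expR v - expR (- v).
  rewrite le_eqVlt => /predU1P[<-|v0]; first by rewrite mulr0 oppr0 subrr.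
  have dk (y : R) : is_derive y 1 (fun z => expR z - expR (- z) - 2 * z)
      (expR y + expR (- y) - 2).
    have hN : is_derive y 1 (fun z : R => - 1 * z + 0) (- 1) by exact: is_derive1_affine.
    have h1 := is_derive1_comp_fun (g := fun z : R => - 1 * z + 0) (is_derive_expR _) hN.
    have h2 := is_deriveB (is_deriveB (is_derive_expR y) h1) (is_derive1_affine 2 0 y).
    rewrite (_ : (fun z => _) = expR - (fun z => expR (- 1 * z + 0)) - (fun z => 2 * z + 0)).
      by apply: is_derive_eq h2 _; rewrite mulN1r addr0; ring.
    by apply/funext => z; rewrite !fctE mulN1r !addr0.
  have [c _] := @MVT R (fun z => expR z - expR (- z) - 2 * z) _ 0 v v0
    (fun y _ => dk y) (continuous_subspaceT (is_derive1_continuous dk)).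
  rewrite !(oppr0, addr0, subrr, mulr0) => e.
  have : 0 <= (expR c + expR (- c) - 2) * v.
    rewrite mulr_ge0 ?(ltW v0)//.
    have e1 : expR (- c) * expR c = 1 by rewrite mulrC expRxMexpNx_1.
    by have := sqr_ge0 (expR c - expR (- c)); have := expR_gt0 c; have := expR_gt0 (- c); nra.
  by rewrite -e subr_ge0.
have u20 : 0 <= u / 2 by rewrite divr_ge0.
have := key _ u20; rewrite mulrC divfK// => h.
have e1 : expR (u / 2) ^+ 2 = expR u by rewrite -expRM_natl mulrC divfK.
have e2 : expR (- (u / 2)) ^+ 2 = expR (- u) by rewrite -expRM_natl mulrN mulrC divfK.
have e3 : expR (u / 2) * expR (- (u / 2)) = 1 by exact: expRxMexpNx_1.
rewrite -e1 -e2.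
have : u ^+ 2 <= (expR (u / 2) - expR (- (u / 2))) ^+ 2.
  by rewrite ler_pXn2r ?nnegrE// (le_trans u0).
have -> : (expR (u / 2) - expR (- (u / 2))) ^+ 2 =
  expR (u / 2) ^+ 2 + expR (- (u / 2)) ^+ 2 - 2 * (expR (u / 2) * expR (- (u / 2))) by ring.
by rewrite e3; lra.
Qed.

Context d (T : measurableType d) (P : probability T R).

(** Bounding the second moment by exponential moments avoids computing the
    moments of order up to four of the normal law. *)
Lemma second_moment_le_laplace (X : T -> R) (s K : R) : measurable_fun [set: T] X ->
  0 < s ->
  (\int[P]_w (expR (s * X w))%:E <= (expR K)%:E)%E ->
  (\int[P]_w (expR (- s * X w))%:E <= (expR K)%:E)%E ->
  K < 1 ->
  (\int[P]_w (X w ^+ 2)%:E <= (2 * K / (1 - K) / s ^+ 2)%:E)%E.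
Proof.
move=> mX s0 h1 h2 K1.
have mE (t : R) : measurable_fun [set: T] (fun w => (expR (t * X w))%:E).
  apply/measurable_EFinP; apply: measurableT_comp; first exact: measurable_expR.
  exact: measurable_funM.
have mX2 : measurable_fun [set: T] (fun w => (X w ^+ 2)%:E).
  by apply/measurable_EFinP; exact: measurable_funX.
have PT : P [set: T] = 1%E by exact: probability_setT.
have : (\int[P]_w ((s ^+ 2)%:E * (X w ^+ 2)%:E + 2%:E) <=
    \int[P]_w ((expR (s * X w))%:E + (expR (- s * X w))%:E))%E.
  apply: ge0_le_integral => //.
  - by move=> w _; rewrite -EFinM -EFinD lee_fin addr_ge0// mulr_ge0 ?sqr_ge0.
  - by apply: emeasurable_funD => //; exact: measurable_funeM.
  - by apply: emeasurable_funD; exact: mE.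
  - move=> w _; rewrite -EFinM -!EFinD lee_fin mulNr -exprMn.
    exact: sqr_le_exp_sum.
rewrite ge0_integralD//; last 2 first.
- by move=> w _; rewrite -EFinM lee_fin mulr_ge0 ?sqr_ge0.
- exact: measurable_funeM.
rewrite ge0_integralZl//; last 2 first.
- by move=> w _; rewrite lee_fin sqr_ge0.
- by rewrite lee_fin sqr_ge0.
rewrite integral_cst// [X in (_ + 2%:E * X)%E](_ : _ = 1%E); last exact: PT.
rewrite mule1 ge0_integralD//.
move=> /le_trans /(_ (leeD h1 h2)).
have V0 : (0 <= \int[P]_w (X w ^+ 2)%:E)%E.
  by apply: integral_ge0 => w _; rewrite lee_fin sqr_ge0.
have s20 : 0 < s ^+ 2 by rewrite exprn_gt0.
case: (\int[P]_w (X w ^+ 2)%:E)%E V0 => [V V0|_|//]; last first.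
  by rewrite gt0_muley ?lte_fin.
rewrite -EFinM -!EFinD !lee_fin => hV.
rewrite ler_pdivlMr//.
have hK : expR K - 1 <= K / (1 - K).
  have := expR_ge1Dx (- K); have e1 : expR (- K) * expR K = 1 by rewrite mulrC expRxMexpNx_1.
  have eK := expR_gt0 K; have K10 : 0 < 1 - K by lra.
  by rewrite ler_pdivlMr//; nra.
have -> : 2 * K / (1 - K) = 2 * (K / (1 - K)) by ring.
by lra.
Qed.

Lemma integral_parabola (mu0 r : R) : 0 < r ->
  (\int[lebesgue_measure]_(x in `[(mu0 - r)%R, (mu0 + r)%R]) (r ^+ 2 - (x - mu0) ^+ 2)%:E
    = (4 / 3 * r ^+ 3)%:E)%E.
Proof.
move=> r0.
pose f (x : R) := r ^+ 2 - (x - mu0) ^+ 2.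
pose F (x : R) := r ^+ 2 * (x - mu0) - 3^-1 * ((x - mu0) * (x - mu0) ^+ 2).
have dF (x : R) : is_derive x 1 F (f x).
  have h1 : is_derive x 1 (fun y : R => 1 * y - mu0) 1 by exact: is_derive1_affine.
  have h2 := is_derive1_comp_fun (g := fun y : R => 1 * y - mu0) (is_derive1_sqr _) h1.
  have h3 := is_derive1M h1 h2.
  have h4 := is_derive1M (is_derive_cst (r ^+ 2) x 1) h1.
  have h5 := is_derive1M (is_derive_cst (3^-1 : R) x 1) h3.
  have h6 := is_deriveB h4 h5.
  rewrite (_ : F = (fun y => cst (r ^+ 2) y * (1 * y - mu0)) -
    (fun y => cst (3^-1) y * ((1 * y - mu0) * (1 * y - mu0) ^+ 2))); last first.
    by apply/funext => y; rewrite !fctE /F !mul1r.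
  by apply: is_derive_eq h6 _; rewrite /= /f; field.
have cf : continuous f.
  apply: (@is_derive1_continuous _ _ (fun x => 0 - 2 * (1 * x - mu0) * 1)) => x.
  have h1 : is_derive x 1 (fun y : R => 1 * y - mu0) 1 by exact: is_derive1_affine.
  have h2 := is_derive1_comp_fun (g := fun y : R => 1 * y - mu0) (is_derive1_sqr _) h1.
  have h3 := is_deriveB (is_derive_cst (r ^+ 2) x 1) h2.
  rewrite (_ : f = cst (r ^+ 2) - (fun y : R => (1 * y - mu0) ^+ 2))//.
  by apply/funext => y; rewrite !fctE /f !mul1r.
have ab : mu0 - r < mu0 + r by lra.
have cF : continuous F by exact: is_derive1_continuous dF.
rewrite (@continuous_FTC2 _ f F)//.
- by rewrite -EFinB; congr EFin; rewrite /F; field.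
- exact: continuous_subspaceT.
- split.
  + by move=> x _; have [] := dF x.
  + by apply: cvg_at_right_filter; exact: cF.
  + by apply: cvg_at_left_filter; exact: cF.
- by move=> x _; rewrite derive1E (@derive_val _ _ _ _ _ _ _ (dF x)).
Qed.

(** Among the densities bounded by [M], the second moment about [mu0] is least
    for the uniform law on the interval of radius [r = 1 / (2 M)] around [mu0].
    Indeed [q u^2 + M (r^2 - u^2) 1_(|u| <= r) >= r^2 q] holds pointwise with
    [u = x - mu0], and integrates to the claim. *)
Lemma density_second_moment_ge (W : T -> R) (q : R -> R) (M mu0 V : R) :
  measurable_fun [set: T] W -> is_density P W q -> 0 < M -> (forall x, q x <= M) ->
  (\int[P]_w ((W w - mu0) ^+ 2)%:E <= V%:E)%E ->
  (12 * M ^+ 2)^-1 <= V.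
Proof.
move=> mW qW M0 qM hV.
have [mq q0 _] := qW.
pose r := (2 * M)^-1.
have r0 : 0 < r by rewrite invr_gt0 mulr_gt0.
pose I := `[mu0 - r, mu0 + r]%classic.
have mI : measurable I by exact: measurable_itv.
have mX : measurable_fun [set: R] (fun x => (x - mu0) ^+ 2).
  by apply: measurable_funX; exact: measurable_funB.
pose g x := M * ((r ^+ 2 - (x - mu0) ^+ 2) * \1_I x).
have Iu x : I x -> (x - mu0) ^+ 2 <= r ^+ 2.
  rewrite /I/= in_itv/= => /andP[h1 h2].
  by rewrite -[leLHS]real_normK ?num_real// ler_pXn2r ?nnegrE ?(ltW r0)// ler_norml; lra.
have g0 x : 0 <= g x.
  rewrite /g mulr_ge0 ?(ltW M0)// indicE; have [xI|] := boolP (x \in I); last by rewrite mulr0.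
  by rewrite mulr1 subr_ge0 Iu// -inE.
have mg : measurable_fun [set: R] g.
  apply: measurable_funM => //; apply: measurable_funM => //.
  exact: measurable_funB.
have hq1 : (\int[lebesgue_measure]_x ((r ^+ 2)%:E * (q x)%:E) = (r ^+ 2)%:E)%E.
  rewrite ge0_integralZl//; last 3 first.
  - exact/measurable_EFinP.
  - by move=> x _; rewrite lee_fin.
  - by rewrite lee_fin sqr_ge0.
  have [_ _ /(_ _ measurableT)] := qW.
  rewrite preimage_setT => <-.
  by rewrite [X in (_ * X)%E](_ : _ = 1%E) ?mule1//; exact: probability_setT.
have : (\int[lebesgue_measure]_x ((r ^+ 2)%:E * (q x)%:E) <=
    \int[lebesgue_measure]_x ((q x * (x - mu0) ^+ 2)%:E + (g x)%:E))%E.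
  apply: ge0_le_integral => //.
  - by move=> x _; rewrite -EFinM lee_fin mulr_ge0 ?sqr_ge0.
  - by apply/measurable_EFinP; exact: measurable_funM.
  - by apply/measurable_EFinP; apply: measurable_funD => //; exact: measurable_funM.
  move=> x _; rewrite -EFinM -EFinD lee_fin /g indicE.
  have [xI|xI] := boolP (x \in I).
    rewrite mulr1 -subr_ge0.
    have -> : q x * (x - mu0) ^+ 2 + M * (r ^+ 2 - (x - mu0) ^+ 2) - r ^+ 2 * q x =
      (M - q x) * (r ^+ 2 - (x - mu0) ^+ 2) by ring.
    by rewrite mulr_ge0 ?subr_ge0// Iu// -inE.
  rewrite !mulr0 addr0 mulrC ler_wpM2l// leNgt; apply/negP => h.
  move/negP: xI; apply; rewrite inE /I/= in_itv/=.
  have : `|x - mu0| <= r.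
    rewrite -(ger0_norm (ltW r0)) -!sqrtr_sqr ler_wsqrtr//; exact: ltW.
  by rewrite ler_norml; lra.
rewrite hq1 ge0_integralD//; last 4 first.
- by move=> x _; rewrite lee_fin mulr_ge0 ?sqr_ge0.
- by apply/measurable_EFinP; exact: measurable_funM.
- by move=> x _; rewrite lee_fin.
- exact/measurable_EFinP.
rewrite -(integral_density mW qW mX); last by move=> x; exact: sqr_ge0.
have -> : (\int[lebesgue_measure]_x (g x)%:E = (M * (4 / 3 * r ^+ 3))%:E)%E.
  transitivity (\int[lebesgue_measure]_(x in I) (M%:E * (r ^+ 2 - (x - mu0) ^+ 2)%:E))%E.
    rewrite [RHS]integral_mkcond; apply: eq_integral => x _.
    by rewrite patchE /g indicE; case: (x \in I); rewrite ?mulr1 ?mulr0 ?EFinM.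
  rewrite ge0_integralZl//; last 3 first.
  - by apply/measurable_EFinP; apply: measurable_funTS; exact: measurable_funB.
  - by move=> x Ix; rewrite lee_fin subr_ge0 Iu.
  - by rewrite lee_fin ltW.
  by rewrite integral_parabola// -EFinM.
move=> h.
have := le_trans h (leeD2r _ hV).
rewrite -EFinD lee_fin.
have -> : (12 * M ^+ 2)^-1 = r ^+ 2 - M * (4 / 3 * r ^+ 3).
  by rewrite /r; field; rewrite gt_eqF.
by lra.
Qed.

End second_moment.

Section lower_bound.
Context d (T : measurableType d) (R : realType) (P : probability T R).
Notation mu := (@lebesgue_measure R).

(** A bound on the density over the positive half-axis becomes a bound
    everywhere once the density is set to [0] elsewhere. This keeps it a
    density: [W >= 0], and the law of [W] has no atom at [0]. *)
Lemma is_density_restrict_pos (W : T -> R) (p : R -> R) :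
  measurable_fun [set: T] W -> (forall w, 0 <= W w) -> is_density P W p ->
  is_density P W (fun x => p x * \1_(`]0, +oo[%classic) x).
Proof.
move=> mW W0 [mp p0 PW].
have mpos : measurable (`]0, +oo[%classic : set R) by exact: measurable_itv.
split.
- exact: measurable_funM.
- by move=> x; rewrite mulr_ge0.
move=> B mB.
have mpre (A : set R) : measurable A -> measurable (W @^-1` A).
  by move=> mA; rewrite -[X in measurable X]setTI; exact: mW.
have mB1 : measurable (B `&` `]0, +oo[%classic) by exact: measurableI.
have mB0 : measurable (B `&` [set (0 : R)]) by exact: measurableI.
have -> : W @^-1` B = W @^-1` (B `&` `]0, +oo[%classic) `|` W @^-1` (B `&` [set 0]).
  apply/seteqP; split=> [w /= Bw|w /= [[]//|[]//]].
  have := W0 w; rewrite le_eqVlt => /predU1P[/esym e|e]; first by right.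
  by left; split => //; rewrite in_itv/= e.
rewrite measureU0; first last.
- apply: (eq_trans (PW _ mB0)); apply: null_set_integral => //.
    by apply/measurable_EFinP; apply: measurable_funTS.
  apply/eqP; rewrite eq_le measure_ge0 andbT -(lebesgue_measure_set1 (0 : R)).
  by apply: le_measure; rewrite ?inE// => x [].
- exact: mpre.
- exact: mpre.
apply: (eq_trans (PW _ mB1)).
rewrite integral_mkcond [RHS]integral_mkcond; apply: eq_integral => x _.
rewrite !patchE indicE in_setI; case: (x \in B) => //=.
by case: (x \in _); rewrite ?mulr1 ?mulr0.
Qed.

Context (n : nat) (Z : 'I_n -> {RV P >-> R}).
Hypothesis Znormal : forall k, standard_normal (Z k).
Hypothesis Zind : mutually_independent Z.
Variables lam a : 'I_n -> R.
Hypothesis lam0 : forall k, 0 <= lam k.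
Let W := quad_form_rv lam a Z.
Let m := \sum_k lam k * (1 + a k ^+ 2).
Let D := \sum_k lam k ^+ 2 + \sum_k lam k ^+ 2 * a k ^+ 2.

(** As [eps] tends to [0] this is [E (W - m)^2 <= 4 D]. The exact variance is
    [2 A1 + 4 B1]; the loss comes from [ln (1 + x) >= x / (1 + x)] and is the
    one that the final constant allows. *)
Lemma quad_form_second_moment (eps : R) : 0 < eps <= 2^-1 ->
  (\int[P]_w ((W w - m) ^+ 2)%:E <= (4 * D / (1 - eps) ^+ 2)%:E)%E.
Proof.
move=> /andP[e0 e2].
have D0 : 0 <= D.
  by rewrite addr_ge0//; apply: sumr_ge0 => k _; rewrite ?sqr_ge0// mulr_ge0 ?sqr_ge0.
(* [s] is so small that [|2 s lam_k| <= eps] and [K <= eps] *)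
pose L := \sum_k lam k.
have L0 : 0 <= L by apply: sumr_ge0.
have lamL k : lam k <= L by rewrite /L (bigD1 k)//= lerDl sumr_ge0.
pose N := 4 * (L + D + 1).
have N0 : 0 < N by rewrite /N; lra.
pose s := eps / N.
have s0 : 0 < s by rewrite divr_gt0.
have sN : s * N = eps by rewrite /s divfK// gt_eqF.
have sL : 0 <= s * L by rewrite mulr_ge0// ltW.
have sD : 0 <= s * D by rewrite mulr_ge0// ltW.
have sNE : 4 * (s * L) + 4 * (s * D) + 4 * s = eps by rewrite -sN /N; ring.
have slam k : `|2 * s * lam k| <= eps.
  have h1 : 0 <= s * lam k by rewrite mulr_ge0// ltW.
  have h2 : s * lam k <= s * L by rewrite ler_pM2l.
  have -> : `|2 * s * lam k| = 2 * (s * lam k) by rewrite -mulrA ger0_norm// mulr_ge0.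
  by lra.
have slamN k : `|2 * - s * lam k| <= eps by rewrite mulrN mulNr normrN.
have eps1 : eps < 1 by lra.
pose K := 2 * s ^+ 2 * D / (1 - eps).
have e10 : 0 < 1 - eps by lra.
have Ke : K <= eps.
  rewrite /K ler_pdivrMr//.
  have : s * (s * D) <= 1 * (s * D) by rewrite ler_wpM2r//; lra.
  rewrite mulrA -expr2 => h.
  have : eps * eps <= eps * 2^-1 by rewrite ler_pM2l.
  by lra.
have mX : measurable_fun [set: T] (fun w => W w - m).
  by apply: measurable_funB => //; exact: measurable_quad_form.
have h1 := @laplace_quad_form _ _ _ _ _ _ Znormal Zind lam a s eps eps1 slam.
have h2 := @laplace_quad_form _ _ _ _ _ _ Znormal Zind lam a (- s) eps eps1 slamN.
rewrite sqrrN in h2.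
have K1 : K < 1 by lra.
apply: (le_trans (second_moment_le_laplace mX s0 h1 h2 K1)).
rewrite lee_fin.
have K10 : 0 < 1 - K by lra.
have -> : 2 * K / (1 - K) / s ^+ 2 = 4 * D / ((1 - eps) * (1 - K)).
  by rewrite {1}/K; field; rewrite !gt_eqF.
rewrite ler_wpM2l ?mulr_ge0// lef_pV2 ?posrE ?mulr_gt0 ?exprn_gt0//.
by rewrite expr2 ler_pM2l//; lra.
Qed.

Lemma quad_form_density_ge (p : R -> R) (b : R) : is_density P W p -> 0 < b ->
  0 < D ->
  (forall x : R, 0 < x -> p x <= b) ->
  1 / (4 * Num.sqrt 3) * (1 / Num.sqrt D) <= b.
Proof.
move=> pW b0 D0 pb.
have mW : measurable_fun [set: T] W by exact: measurable_quad_form.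
have W0 w : 0 <= W w by apply: sumr_ge0 => k _; rewrite mulr_ge0 ?sqr_ge0.
have qW := is_density_restrict_pos mW W0 pW.
have qb x : p x * \1_(`]0, +oo[%classic) x <= b.
  rewrite indicE; have [|_] := boolP (x \in _); last by rewrite mulr0 ltW.
  by rewrite inE/= in_itv/= andbT mulr1 => /pb.
pose c := (12 * b ^+ 2)^-1.
have c0 : 0 < c by rewrite invr_gt0 mulr_gt0 ?exprn_gt0.
have ce (eps : R) : 0 < eps <= 2^-1 -> c * (1 - 2 * eps) <= 4 * D.
  move=> he; have e10 : 0 < 1 - eps by case/andP: he; lra.
  have := density_second_moment_ge mW qW b0 qb (quad_form_second_moment he).
  rewrite ler_pdivlMr ?exprn_gt0// -/c => h.
  apply: le_trans h; rewrite ler_pM2l//.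
  by have := sqr_ge0 eps; lra.
have cD : c <= 4 * D.
  apply/ler_addgt0Pr => e e0.
  have ce0 : 0 < c + e by lra.
  pose eps := e / (2 * (c + e)).
  have eps0 : 0 < eps by rewrite divr_gt0// mulr_gt0.
  have eps2 : eps <= 2^-1.
    by rewrite /eps ler_pdivrMr ?mulr_gt0//; lra.
  have := ce eps; rewrite eps0 eps2 => /(_ isT) h.
  have : c * (2 * eps) <= e.
    rewrite /eps; have -> : c * (2 * (e / (2 * (c + e)))) = c * e / (c + e).
      by field; rewrite gt_eqF.
    by rewrite ler_pdivrMr// mulrDr -subr_ge0 (_ : _ - _ = e * e) ?mulr_ge0 ?ltW//; ring.
  by lra.
have sD0 : 0 < Num.sqrt D by rewrite sqrtr_gt0.
have s30 : 0 < Num.sqrt (3 : R) by rewrite sqrtr_gt0.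
have q0 : 0 < 4 * Num.sqrt 3 * Num.sqrt D by rewrite !mulr_gt0.
have -> : 1 / (4 * Num.sqrt 3) * (1 / Num.sqrt D) = (4 * Num.sqrt 3 * Num.sqrt D)^-1.
  by field; rewrite !gt_eqF.
rewrite -[leRHS]invrK lef_pV2 ?posrE ?invr_gt0//.
rewrite -(ler_pXn2r (n := 2)) ?nnegrE ?invr_ge0 ?(ltW q0) ?(ltW b0)//.
rewrite exprVn !exprMn !sqr_sqrtr ?(ltW D0)//.
have -> : (b ^+ 2)^-1 = 12 * c by rewrite /c; field; rewrite gt_eqF.
by rewrite -natrX; lra.
Qed.

End lower_bound.

(** * The two-sided bound *)

Theorem theorem2 (d : measure_display) (T : measurableType d) (R : realType)
    (P : probability T R) (n : nat) (n_gt0 : (0 < n)%N)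
    (Z : 'I_n -> {RV P >-> R})
    (Z_normal : forall k, standard_normal (Z k))
    (Z_indep : mutually_independent Z)
    (lam : 'I_n -> R)
    (lam_noninc : forall i j : 'I_n, (i <= j)%N -> lam j <= lam i)
    (lam_gt0 : forall k, 0 < lam k)
    (a : 'I_n -> R)
    (p : R -> R)
    (p_density : is_density P (quad_form_rv lam a Z) p)
    (p_cont : {within `]0, +oo[, continuous p}) :
  let lam1 := lam (Ordinal n_gt0) in
  let A1 := \sum_(k < n) lam k ^+ 2 in
  let B1 := \sum_(k < n) lam k ^+ 2 * a k ^+ 2 in
  let M := sup_density p in
  (lam1 ^+ 2 <= A1 / 3 ->
     ((1 / (4 * Num.sqrt 3) * (1 / Num.sqrt (A1 + B1)))%:E <= M)%E
     /\ (M <= (2 / Num.sqrt (A1 + B1))%:E)%E)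
  /\ ((1 / (4 * Num.sqrt 3) * (1 / Num.sqrt (A1 + B1)))%:E <= M)%E.
Proof.
move=> lam1 A1 B1 M.
have A1_gt0 : 0 < A1.
  rewrite /A1 (bigD1 (Ordinal n_gt0))//= ltr_wpDr ?exprn_gt0//.
  by apply: sumr_ge0 => k _; exact: sqr_ge0.
have B1_ge0 : 0 <= B1 by apply: sumr_ge0 => k _; rewrite mulr_ge0 ?sqr_ge0.
have D_gt0 : 0 < A1 + B1 by rewrite ltr_pwDl.
have lam_ge0 k : 0 <= lam k by exact: ltW.
have pM (x : R) : 0 < x -> ((p x)%:E <= M)%E.
  move=> x0; apply: ereal_sup_ubound; exists x => //.
  by rewrite /= in_itv/= x0.
have lower : ((1 / (4 * Num.sqrt 3) * (1 / Num.sqrt (A1 + B1)))%:E <= M)%E.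
  have p1 := pM 1 ltr01; have [_ p_ge0 _] := p_density.
  move: pM p1; case: M => [r pM p1|_ _|//]; last by rewrite leey.
  rewrite lee_fin; apply/ler_addgt0Pr => e e0.
  have r0 : 0 <= r by rewrite (le_trans (p_ge0 1)).
  apply: (quad_form_density_ge Z_normal Z_indep lam_ge0 p_density) => //.
    by rewrite ltr_wpDl.
  by move=> x /pM; rewrite lee_fin => /le_trans; apply; rewrite lerDl ltW.
split=> // lam1A; split=> //.
apply: ge_ereal_sup => _ /= [x + <-]; rewrite in_itv/= andbT => x0.
rewrite lee_fin; apply: (quad_form_density_le Z_normal Z_indep A1_gt0 _ p_density) => // k.
apply: le_trans lam1A; rewrite ler_pXn2r ?nnegrE ?lam_ge0//.
exact: lam_noninc.
Qed.
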